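(* Let $R$ be a right noetherian ring and let $(\mathcal X,\mathcal Y)$ be a cotilting torsion pair in the category $\mathrm{Mod}\text{-}R$ of right $R$-modules. The following conditions are equivalent: (1) $(\mathcal X,\mathcal Y)$ satisfies the Reiten-Ringel condition, i.e. whenever $Y\in\mathcal Y$ has a finitely generated submodule $0\neq Y_0\leq Y$ such that $Y/Y_0\in\mathcal X$, then $Y$ is finitely generated; (2) any $1$-cotilting module cogenerating $(\mathcal X,\mathcal Y)$ is $\Sigma$-pure-injective; (3) $(\mathcal X,\mathcal Y)$ is cogenerated by a $\Sigma$-pure-injective $1$-cotilting module.
   Context: Rings are associative with unit. $\mathrm{Prod}\,U$ is the class of all direct summands of direct products of copies of $U$. A right $R$-module $U$ is $1$-cotilting if $\mathrm{Ext}^j_R(U^{\alpha},U)=0$ for all $j>0$ and all cardinals $\alpha$, $U$ has injective dimension at most $1$, and there is an exact sequence $0\to U_1\to U_0\to W\to 0$ with $W$ an injective cogenerator of $\mathrm{Mod}\text{-}R$ and $U_0,U_1\in\mathrm{Prod}\,U$. For a $1$-cotilting module $U$, the class $\{M\mid \mathrm{Ext}^j_R(M,U)=0\ \forall j>0\}$ coincides with the class of modules cogenerated by $U$ and is a torsion-free class; the torsion pair $(\mathcal X,\mathcal Y)$ with this torsion-free class $\mathcal Y$ is said to be cogenerated by $U$, and torsion pairs arising in this way are called cotilting torsion pairs. $U$ is $\Sigma$-pure-injective if every direct sum $U^{(\alpha)}$ of copies of $U$ is pure-injective. *)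

(* Defs.v *)
From HB Require Import structures.
From mathcomp Require Import all_boot all_order all_algebra.
From mathcomp Require Import boolp classical_sets functions cardinality.
Set Implicit Arguments.
Unset Strict Implicit.
Unset Printing Implicit Defensive.
Import GRing.Theory.
Local Open Scope ring_scope.

(* [lmodType S] is the type of left S-modules. All notions below are defined  *)
(* for left modules over an arbitrary ring S, possibly zero; right R-modules  *)
(* are left modules over the opposite ring R^c.                               *)

(* Chain condition on submodules. *)
Definition noetherian_module (S : pzRingType) (M : lmodType S) : Prop :=
  forall I : nat -> {pred M},
    (forall n, submod_closed (I n)) ->
    (forall n, {subset I n <= I n.+1}) ->
    exists n, forall m, (n <= m)%N -> I m =i I n.

(* The submodules of (R^c)^o are the right ideals of R. *)
Definition right_noetherian (R : pzRingType) : Prop :=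
  @noetherian_module R^c (R^c)^o.

Definition finitely_generated (S : pzRingType) (M : lmodType S) : Prop :=
  exists n (v : 'I_n -> M),
    forall x, exists c : 'I_n -> S, x = \sum_i c i *: v i.

(* 0 -> A -> B -> C -> 0 *)
Definition short_exact (S : pzRingType) (A B C : lmodType S)
    (f : {linear A -> B}) (g : {linear B -> C}) : Prop :=
  [/\ injective f,
      forall b, g b = 0 <-> exists a, f a = b
    & forall c, exists b, g b = c].

Definition injective_module (S : pzRingType) (E : lmodType S) : Prop :=
  forall (A B : lmodType S) (f : {linear A -> B}) (g : {linear A -> E}),
    injective f -> exists h : {linear B -> E}, forall a, h (f a) = g a.

Definition projective_module (S : pzRingType) (P : lmodType S) : Prop :=
  forall (A B : lmodType S) (f : {linear A -> B}) (g : {linear P -> B}),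
    (forall b, exists a, f a = b) ->
    exists h : {linear P -> A}, forall x, f (h x) = g x.

(* ... -> P 2 -> P 1 -> P 0 -> M -> 0, with pres_d n : P n.+1 -> P n. *)
Record projective_resolution (S : pzRingType) (M : lmodType S) := ProjRes {
  pres :> nat -> lmodType S;
  pres_d : forall n, {linear pres n.+1 -> pres n};
  pres_aug : {linear pres 0%N -> M};
  _ : forall n, projective_module (pres n);
  _ : forall x, exists y, pres_aug y = x;
  _ : forall x, pres_aug x = 0 <-> exists y, pres_d 0 y = x;
  _ : forall n x, pres_d n x = 0 <-> exists y, pres_d n.+1 y = x
}.

Definition coboundary (S : pzRingType) (M N : lmodType S)
    (P : projective_resolution M) (j : nat) : {linear P j -> N} -> Prop :=
  match j return {linear P j -> N} -> Prop with
  | 0%N => fun f => forall x, f x = 0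
  | k.+1 => fun f => exists g : {linear P k -> N},
                       forall x, f x = g (pres_d P k x)
  end.

(* Ext^j(M, N) = 0: the complex Hom(P, N) has no cohomology in degree j. *)
Definition Ext_eq0 (S : pzRingType) (j : nat) (M N : lmodType S) : Prop :=
  forall (P : projective_resolution M) (f : {linear P j -> N}),
    (forall x, f (pres_d P j x) = 0) -> coboundary f.

Definition inj_dim_le1 (S : pzRingType) (U : lmodType S) : Prop :=
  exists (E0 E1 : lmodType S) (f : {linear U -> E0}) (g : {linear E0 -> E1}),
    [/\ short_exact f g, injective_module E0 & injective_module E1].

(* The direct product U^I is the function space I -> U with its pointwise     *)
(* module structure.                                                          *)
Definition in_Prod (S : pzRingType) (U M : lmodType S) : Prop :=
  exists (I : Type) (i : {linear M -> (I -> U)}) (p : {linear (I -> U) -> M}),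
    forall x, p (i x) = x.

Definition cogenerated (S : pzRingType) (U M : lmodType S) : Prop :=
  exists (I : Type) (f : {linear M -> (I -> U)}), injective f.

Definition injective_cogenerator (S : pzRingType) (W : lmodType S) : Prop :=
  injective_module W /\ forall M : lmodType S, cogenerated W M.

Definition one_cotilting (S : pzRingType) (U : lmodType S) : Prop :=
  [/\ forall (j : nat) (I : Type), (0 < j)%N ->
        @Ext_eq0 S j (I -> U) U,
      inj_dim_le1 U
    & exists (U1 U0 W : lmodType S)
             (f : {linear U1 -> U0}) (g : {linear U0 -> W}),
        [/\ short_exact f g, injective_cogenerator W,
            in_Prod U U0 & in_Prod U U1]].

(* The direct sum of copies of U: functions of finite support inside U^I. *)
Section DirectSum.
Variables (S : pzRingType) (I : Type) (U : lmodType S).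

Definition finite_support : {pred I -> U} :=
  fun f => `[< finite_set [set i | f i <> 0]%classic >].

Lemma finite_support_submod_closed : submod_closed finite_support.
Proof.
split=> [|a f g /asboolP Hf /asboolP Hg]; apply/asboolP.
  by apply: sub_finite_set (finite_set0 I) => i /=; apply.
have Hfg : finite_set ([set i | f i <> 0] `|` [set i | g i <> 0])%classic.
  by rewrite finite_setU.
apply: sub_finite_set Hfg => i /= Hi.
have [fi0|] := eqVneq (f i) 0; last by move/eqP; left.
right=> gi0; apply: Hi.
by rewrite -[LHS]/(a *: f i + g i) fi0 gi0 scaler0 addr0.
Qed.

HB.instance Definition _ := GRing.isSubmodClosed.Build S (I -> U) finite_support
  finite_support_submod_closed.

Record direct_sum := DirectSum {
  direct_sum_fun :> I -> U;
  _ : direct_sum_fun \in finite_support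
}.

HB.instance Definition _ := [isSub for direct_sum_fun].
HB.instance Definition _ := [Choice of direct_sum by <:].
HB.instance Definition _ := [SubChoice_isSubLmodule of direct_sum by <:].

End DirectSum.

(* F is the cokernel of a map between finitely generated free modules. *)
Definition finitely_presented (S : pzRingType) (F : lmodType S) : Prop :=
  exists (m n : nat) (r : {linear 'rV[S]_m -> 'rV[S]_n})
         (p : {linear 'rV[S]_n -> F}),
    (forall y, exists x, p x = y) /\
    (forall x, p x = 0 <-> exists z, r z = x).

Definition pure_exact (S : pzRingType) (A B C : lmodType S)
    (f : {linear A -> B}) (g : {linear B -> C}) : Prop :=
  short_exact f g /\
  forall (F : lmodType S) (h : {linear F -> C}), finitely_presented F ->
    exists k : {linear F -> B}, forall x, g (k x) = h x.

Definition pure_injective (S : pzRingType) (M : lmodType S) : Prop :=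
  forall (A B C : lmodType S) (f : {linear A -> B}) (g : {linear B -> C})
         (u : {linear A -> M}),
    pure_exact f g -> exists h : {linear B -> M}, forall a, h (f a) = u a.

Definition Sigma_pure_injective (S : pzRingType) (U : lmodType S) : Prop :=
  forall I : Type, pure_injective (direct_sum I U).

Definition torsion_pair (S : pzRingType) (X Y : lmodType S -> Prop) : Prop :=
  (forall M, X M <->
     forall (N : lmodType S) (f : {linear M -> N}), Y N -> forall x, f x = 0) /\
  (forall N, Y N <->
     forall (M : lmodType S) (f : {linear M -> N}), X M -> forall x, f x = 0).

Definition cogenerates (S : pzRingType) (U : lmodType S)
    (X Y : lmodType S -> Prop) : Prop :=
  torsion_pair X Y /\
  forall M, Y M <-> forall j, (0 < j)%N -> Ext_eq0 j M U.

Definition cotilting_torsion_pair (S : pzRingType)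
    (X Y : lmodType S -> Prop) : Prop :=
  exists U : lmodType S, one_cotilting U /\ cogenerates U X Y.

(* The submodule N0 of N is given by its inclusion f, and the quotient N / N0 *)
(* by the cokernel g of f; X is closed under isomorphism in a torsion pair.   *)
Definition Reiten_Ringel (S : pzRingType) (X Y : lmodType S -> Prop) : Prop :=
  forall (N0 N Q : lmodType S) (f : {linear N0 -> N}) (g : {linear N -> Q}),
    short_exact f g -> Y N -> finitely_generated N0 ->
    (exists x : N0, x <> 0) -> X Q -> finitely_generated N.

(* Main.v *)
(* Write 0 -> U -> E0 -> E1 -> 0 for an injective coresolution of U. A module M lies
   in Y iff every map M -> E1 lifts to E0. For a module Q let tau Q be the union of
   its finitely generated submodules in X; since R is noetherian, all the finitely
   generated submodules of Q / tau Q lie in Y.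

   (3) => (1): U is pure-injective, so a module lies in Y as soon as its finitely
   generated submodules do; hence Q = N/N_0 in X equals tau Q. If it were not
   finitely generated, a strict chain T_n of finitely generated submodules of N over
   N_0, with T_n/N_0 in X, would give maps T_n -> U not extending to T_{n+1}, which
   is impossible because U^(N) is a direct summand of U^N.

   (1) => (2): a diagonal version of Bazzoni's counting argument shows that Y is
   closed under countable increasing unions. With the Reiten-Ringel condition, every
   nonzero module C whose finitely generated submodules lie in Y then has a nonzero
   finitely generated submodule T such that C/T has the same property, namely the
   preimage of tau (C/c) for a cyclic submodule c of C. By Eklof's argument
   Ext^1(C, W) = 0 whenever Ext^1(F, W) = 0 for all finitely generated F in Y; this
   applies to W = U and to W = U^(I). Hence Y is closed under direct limits, which
   makes U^(I), being in Y and Ext-orthogonal to Y, pure-injective. *)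
From HB Require Import structures.
Require Import Defs.
From mathcomp Require Import all_boot all_order all_algebra.
From mathcomp Require Import boolp classical_sets functions cardinality fsbigop.
Set Implicit Arguments.
Unset Strict Implicit.
Unset Printing Implicit Defensive.
Import GRing.Theory.
Local Open Scope ring_scope.

(** * Submodules, their inclusions, and linear maps obtained from existence proofs *)

Section LinearMaps.
Variable S : pzRingType.

Lemma linear_exists (A B : lmodType S) (f : A -> B) :
  linear f -> exists g : {linear A -> B}, forall x, g x = f x.
Proof.
move=> fL; pose m := GRing.isLinear.Build S A B *:%R f fL.
pose g : {linear A -> B} := HB.pack f m.
by exists g.
Qed.

(** Membership takes values in [Prop], so submodules given by existential conditions can be written
    directly; [submodule_pred] recovers the boolean form that the algebraic hierarchy expects. *)
Record submodule (M : lmodType S) := Submodule {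
  in_submodule :> M -> Prop;
  submoduleP : in_submodule 0 /\
    forall a x y, in_submodule x -> in_submodule y -> in_submodule (a *: x + y)
}.

Section Submodule.
Variables (M : lmodType S) (D : submodule M).

Lemma sub0 : D 0. Proof. by case: (submoduleP D). Qed.
Lemma subL a x y : D x -> D y -> D (a *: x + y).
Proof. by case: (submoduleP D) => _; apply. Qed.
Lemma subD x y : D x -> D y -> D (x + y).
Proof. by rewrite -[x in x + y]scale1r; apply: subL. Qed.
Lemma subZ a x : D x -> D (a *: x).
Proof. by move=> Dx; rewrite -[_ *: _]addr0; apply: subL (sub0). Qed.
Lemma subN x : D x -> D (- x).
Proof. by rewrite -scaleN1r; apply: subZ. Qed.
Lemma subB x y : D x -> D y -> D (x - y).
Proof. by move=> ? /subN; apply: subD. Qed.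
Lemma sub_sum I (r : seq I) (P : pred I) (F : I -> M) :
  (forall i, P i -> D (F i)) -> D (\sum_(i <- r | P i) F i).
Proof. by move=> H; elim/big_ind: _ => //; [exact: sub0 | exact: subD]. Qed.

Definition submodule_pred : {pred M} := fun x => `[< D x >].

Lemma submodule_pred_closed : submod_closed submodule_pred.
Proof.
split=> [|a x y /asboolP Dx /asboolP Dy]; apply/asboolP; first exact: sub0.
exact: subL.
Qed.

HB.instance Definition _ := GRing.isSubmodClosed.Build S M submodule_pred
  submodule_pred_closed.

Record submodule_type := SubmoduleElt {
  submodule_val :> M;
  _ : submodule_val \in submodule_pred
}.

HB.instance Definition _ := [isSub for submodule_val].
HB.instance Definition _ := [Choice of submodule_type by <:].
HB.instance Definition _ := [SubChoice_isSubLmodule of submodule_type by <:].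

Definition submod : lmodType S := submodule_type.
Lemma submodule_inclusion : exists i : {linear submod -> M},
  [/\ injective i, forall x, D (i x) & forall x, D x -> exists y, i y = x].
Proof.
exists val; split; [exact: val_inj | by case=> x /= /asboolP |].
by move=> x Dx; exists (SubmoduleElt (asboolT Dx)).
Qed.

(* Chosen from an existence lemma so that simplification leaves it folded. *)
Definition incl : {linear submod -> M} := projT1 (cid submodule_inclusion).

Lemma incl_inj : injective incl.
Proof. by rewrite /incl; case: cid => i []. Qed.
Lemma inclP x : D (incl x).
Proof. by move: x; rewrite /incl; case: cid => i []. Qed.
Lemma incl_onto x : D x -> exists y, incl y = x.
Proof. by move: x; rewrite /incl; case: cid => i []. Qed.

Lemma corestrict (A : lmodType S) (f : {linear A -> M}) :
  (forall x, D (f x)) -> exists g : {linear A -> submod}, forall x, incl (g x) = f x.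
Proof.
move=> Df; have /choice[g gE] x : exists y, incl y = f x by exact: incl_onto.
have gL : linear g by move=> a x y; apply: incl_inj; rewrite linearP !gE linearP.
by have [h hE] := linear_exists gL; exists h => x; rewrite hE.
Qed.

End Submodule.
End LinearMaps.

(** * Quotient modules *)

Section Quotient.
Variables (S : pzRingType) (M : lmodType S) (D : submodule M).

(** The representative is chosen from the coset seen as a set: congruent elements have extensionally
    equal cosets, hence the same representative. The quotient can then be the subtype of fixed
    points of [coset_repr]. *)
Definition coset_repr (x : M) : M := xget 0 [set y | D (x - y)]%classic.

Lemma coset_reprP x : D (x - coset_repr x).
Proof.
rewrite /coset_repr; case: xgetP => [y _ //|/(_ x)[]].
by rewrite /= subrr; exact: sub0.
Qed.

Lemma eq_coset_repr x y : coset_repr x = coset_repr y <-> D (x - y).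
Proof.
split=> [xy|Dxy].
  have -> : x - y = (x - coset_repr x) - (y - coset_repr y).
    by rewrite xy opprB addrA subrK.
  by apply: subB; exact: coset_reprP.
rewrite /coset_repr; congr xget; apply/seteqP; split=> z /= Dz.
  by rewrite -(subrKA x) -opprB addrC; apply: subB.
by rewrite -(subrKA y); apply: subD.
Qed.

Lemma coset_reprK x : coset_repr (coset_repr x) = coset_repr x.
Proof. by apply/eq_coset_repr; rewrite -opprB; apply/subN/coset_reprP. Qed.

Record quotient_type := Coset {
  coset_val : M;
  _ : coset_repr coset_val == coset_val
}.
HB.instance Definition _ := [isSub for coset_val].
HB.instance Definition _ := [Choice of quotient_type by <:].

Definition coset (x : M) : quotient_type :=
  Coset (introT eqP (coset_reprK x)).

Lemma coset_valK x : coset (coset_val x) = x.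
Proof. by apply: val_inj; case: x => x /= /eqP. Qed.

Lemma eq_coset x y : coset x = coset y <-> D (x - y).
Proof. by rewrite -eq_coset_repr; split=> [[]|] // ?; apply: val_inj. Qed.

Lemma cosetK x : D (x - coset_val (coset x)).
Proof. exact: coset_reprP. Qed.

Let addq u v := coset (coset_val u + coset_val v).
Let oppq u := coset (- coset_val u).
Let scaleq a u := coset (a *: coset_val u).

Let addqE x y : addq (coset x) (coset y) = coset (x + y).
Proof.
apply/eq_coset; rewrite -opprB; apply: subN.
by rewrite opprD addrACA; apply: subD; exact: cosetK.
Qed.
Let oppqE x : oppq (coset x) = coset (- x).
Proof. by apply/eq_coset; rewrite opprK addrC; exact: cosetK. Qed.
Let scaleqE a x : scaleq a (coset x) = coset (a *: x).
Proof. by apply/eq_coset; rewrite -scalerBr -opprB; apply/subZ/subN/cosetK. Qed.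

Let quotE u : exists x, u = coset x.
Proof. by exists (coset_val u); rewrite coset_valK. Qed.

Let addqA : associative addq.
Proof.
move=> u v w; have [[x ->] [y ->] [z ->]] := And3 (quotE u) (quotE v) (quotE w).
by rewrite !addqE addrA.
Qed.
Let addqC : commutative addq.
Proof. by move=> u v; rewrite /addq addrC. Qed.
Let add0q : left_id (coset 0) addq.
Proof. by move=> u; have [x ->] := quotE u; rewrite addqE add0r. Qed.
Let addNq : left_inverse (coset 0) oppq addq.
Proof. by move=> u; have [x ->] := quotE u; rewrite oppqE addqE addNr. Qed.

HB.instance Definition _ :=
  GRing.isZmodule.Build quotient_type addqA addqC add0q addNq.

Let scaleqA a b u : scaleq a (scaleq b u) = scaleq (a * b) u.
Proof. by have [x ->] := quotE u; rewrite !scaleqE scalerA. Qed.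
Let scale1q : left_id 1 scaleq.
Proof. by move=> u; have [x ->] := quotE u; rewrite scaleqE scale1r. Qed.
Let scaleqDr : right_distributive scaleq +%R.
Proof.
move=> a u v; have [[x ->] [y ->]] := conj (quotE u) (quotE v).
by rewrite [_ + _]addqE !scaleqE [RHS]addqE scalerDr.
Qed.
Let scaleqDl u : {morph scaleq^~ u : a b / a + b}.
Proof.
by move=> a b; have [x ->] := quotE u; rewrite !scaleqE [RHS]addqE scalerDl.
Qed.

HB.instance Definition _ := GRing.Zmodule_isLmodule.Build S quotient_type
  scaleqA scale1q scaleqDr scaleqDl.

Definition quot : lmodType S := quotient_type.

Lemma coset_linear : linear (coset : M -> quot).
Proof.
move=> a x y.
by rewrite -[RHS]/(addq (scaleq a (coset x)) (coset y)) scaleqE addqE.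
Qed.
HB.instance Definition _ := GRing.isLinear.Build S M quot *:%R coset coset_linear.

Lemma quotient_projection : exists p : {linear M -> quot},
  (forall u, exists x, p x = u) /\ forall x, p x = 0 <-> D x.
Proof.
exists coset; split=> [u|x]; first by exists (coset_val u); exact: coset_valK.
by rewrite -(linear0 coset) -{2}[x]subr0; exact: eq_coset.
Qed.

Definition proj : {linear M -> quot} := projT1 (cid quotient_projection).

Lemma proj_onto u : exists x, proj x = u.
Proof. by move: u; rewrite /proj; case: cid => p []. Qed.

Lemma proj_eq0 x : proj x = 0 <-> D x.
Proof. by move: x; rewrite /proj; case: cid => p []. Qed.

End Quotient.

(** * Factoring and lifting linear maps; standard submodules *)

Section Maps.
Variable S : pzRingType.

Lemma factor_onto (A B C : lmodType S) (p : {linear A -> C}) (f : {linear A -> B}) :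
  (forall c, exists a, p a = c) -> (forall a, p a = 0 -> f a = 0) ->
  exists h : {linear C -> B}, forall a, h (p a) = f a.
Proof.
move=> /choice[s sK] fp.
have fpE a b : p a = p b -> f a = f b.
  by move=> ab; apply/subr0_eq; rewrite -linearB fp// linearB ab subrr.
have hL : linear (f \o s).
  by move=> a x y; rewrite /= -linearP; apply: fpE; rewrite linearP !sK.
by have [h hE] := linear_exists hL; exists h => a; rewrite hE; apply: fpE.
Qed.

Lemma lift_inj (A B Z : lmodType S) (i : {linear A -> B}) (f : {linear Z -> B}) :
  injective i -> (forall z, exists a, i a = f z) ->
  exists h : {linear Z -> A}, forall z, i (h z) = f z.
Proof.
move=> iI /choice[h hE].
have hL : linear h by move=> a x y; apply: iI; rewrite linearP !hE linearP.
by have [g gE] := linear_exists hL; exists g => z; rewrite gE.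
Qed.

(** Two values over the same [a] differ by a value over 0, so single-valuedness is a condition at 0
    alone. *)
Lemma linear_of_graph (A B : lmodType S) (G : submodule (A * B)%type) :
  (forall a, exists b, G (a, b)) -> (forall b, G (0, b) -> b = 0) ->
  exists f : {linear A -> B}, forall a, G (a, f a).
Proof.
move=> /choice[f fE] G0.
have fL : linear f.
  move=> a x y; apply/subr0_eq/G0.
  rewrite -[X in (X, _)](subrr (a *: x + y)).
  exact: subB (fE _) (subL _ (fE x) (fE y)).
by have [g gE] := linear_exists fL; exists g => a; rewrite gE.
Qed.

Lemma linear_inj0 (A B : lmodType S) (f : {linear A -> B}) :
  (forall x, f x = 0 -> x = 0) -> injective f.
Proof.
by move=> f0 x y xy; apply/subr0_eq/f0; rewrite linearB xy subrr.
Qed.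

Lemma inj_eq0 (A B : lmodType S) (f : {linear A -> B}) x :
  injective f -> f x = 0 -> x = 0.
Proof. by move=> fI fx; apply: fI; rewrite linear0. Qed.

Definition zero_sub (M : lmodType S) : submodule M.
Proof.
exists (fun x => x = 0); split=> // a x y -> ->.
by rewrite scaler0 addr0.
Defined.

Definition image_sub (A B : lmodType S) (f : {linear A -> B}) (D : submodule A) :
  submodule B.
Proof.
exists (fun y => exists2 x, D x & f x = y); split.
  by exists 0; [exact: sub0 | exact: linear0].
move=> a _ _ [x Dx <-] [y Dy <-].
by exists (a *: x + y); [exact: subL | exact: linearP].
Defined.

Definition full_sub (M : lmodType S) : submodule M.
Proof. by exists (fun x => True). Defined.

Definition range_sub (A B : lmodType S) (f : {linear A -> B}) : submodule B.
Proof.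
exists (fun y => exists x, f x = y); split.
  by exists 0; exact: linear0.
by move=> a _ _ [x <-] [y <-]; exists (a *: x + y); exact: linearP.
Defined.

Definition preim_sub (A B : lmodType S) (f : {linear A -> B}) (D : submodule B) :
  submodule A.
Proof.
exists (fun x => D (f x)); split; first by rewrite linear0; exact: sub0.
by move=> a x y Dx Dy; rewrite linearP; exact: subL.
Defined.

Definition add_sub (M : lmodType S) (D E : submodule M) : submodule M.
Proof.
exists (fun z => exists x y, [/\ D x, E y & x + y = z]); split.
  by exists 0, 0; split; [exact: sub0 | exact: sub0 | exact: addr0].
move=> a _ _ [x [y [Dx Ey <-]]] [x' [y' [Dx' Ey' <-]]].
exists (a *: x + x'), (a *: y + y'); split; [exact: subL|exact: subL|].
by rewrite scalerDr addrACA.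
Defined.

Lemma incl_le (M : lmodType S) (P Q : submodule M) :
  (forall x, P x -> Q x) -> exists f : {linear submod P -> submod Q},
    forall x, incl Q (f x) = incl P x.
Proof. by move=> PQ; apply: corestrict => x; exact/PQ/inclP. Qed.

End Maps.

(** * Direct sums, free modules and projective resolutions *)

Section DirectSums.
Variable S : pzRingType.

Section Single.
Variables (I : Type) (U : lmodType S).

Definition single (i : I) (u : U) : I -> U :=
  fun j => if `[< j = i >] then u else 0.

Lemma singleE i u : single i u i = u.
Proof. by rewrite /single asboolT. Qed.
Lemma single_ne i u j : j <> i -> single i u j = 0.
Proof. by move=> ji; rewrite /single asboolF. Qed.

Lemma single_linear i : linear (single i : U -> (I -> U)).
Proof.
move=> a u v; apply: funext => j.
rewrite -[RHS]/(a *: single i u j + single i v j) /single.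
by case: ifP; rewrite // scaler0 addr0.
Qed.

Lemma single_finite_support i u : single i u \in @Defs.finite_support S I U.
Proof.
apply/asboolP; apply: sub_finite_set (finite_set1 i) => j /= ji.
by apply: contrapT => ne; apply: ji; exact: single_ne.
Qed.

Definition ds_single (i : I) (u : U) : direct_sum I U :=
  DirectSum (single_finite_support i u).

Lemma ds_single_linear i : linear (ds_single i).
Proof. by move=> a u v; apply: val_inj; exact: single_linear. Qed.
HB.instance Definition _ i :=
  GRing.isLinear.Build S U (direct_sum I U) *:%R (ds_single i) (ds_single_linear i).

Definition ds_eval i (x : direct_sum I U) : U := x i.

Lemma ds_eval_linear i : linear (ds_eval i).
Proof. by []. Qed.
HB.instance Definition _ i :=
  GRing.isLinear.Build S (direct_sum I U) U *:%R (ds_eval i) (ds_eval_linear i).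

Definition ds_val : {linear direct_sum I U -> (I -> U)} := val.

Lemma ds_support (x : direct_sum I U) : finite_set [set i | x i <> 0]%classic.
Proof. by case: x => x /= /asboolP. Qed.

End Single.

(** The sum over the support is a finitely supported big operator, whose index type must carry a
    choice structure; [ds_sum_exists] reaches all index types through [{classic I}]. *)
Lemma ds_sum_exists_choice (I : choiceType) (U W : lmodType S)
    (f : I -> {linear U -> W}) :
  exists g : {linear direct_sum I U -> W}, forall i u, g (ds_single i u) = f i u.
Proof.
pose g (x : direct_sum I U) : W := \sum_(i \in [set: I]%classic) f i (x i).
have gE (r : seq I) (x : direct_sum I U) : uniq r -> (forall i, x i <> 0 -> i \in r) ->
    g x = \sum_(i <- r) f i (x i).
  move=> ru xr; rewrite /g (fsbigE r)//; first by under eq_bigl do rewrite in_setT.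
  move=> i _ ir; suff -> : x i = 0 by rewrite linear0.
  by apply: contrapT => /xr; rewrite (negbTE ir).
have gL : linear g.
  move=> a x y; have /finite_seqP[rx rxE] := ds_support x.
  have /finite_seqP[ry ryE] := ds_support y.
  pose r := undup (rx ++ ry).
  have xr i : x i <> 0 -> i \in r.
    move=> xi; rewrite mem_undup mem_cat; apply/orP; left.
    by have : [set` rx]%classic i by rewrite -rxE.
  have yr i : y i <> 0 -> i \in r.
    move=> xi; rewrite mem_undup mem_cat; apply/orP; right.
    by have : [set` ry]%classic i by rewrite -ryE.
  have ru : uniq r by exact: undup_uniq.
  rewrite (gE r x)// (gE r y)// (gE r _ ru); last first.
    move=> i xyi; apply: contrapT => /negP ir; apply: xyi.
    have x0 : x i = 0 by apply: contrapT => /xr; rewrite (negbTE ir).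
    have y0 : y i = 0 by apply: contrapT => /yr; rewrite (negbTE ir).
    by rewrite -[LHS]/(a *: x i + y i) x0 y0 scaler0 addr0.
  rewrite scaler_sumr -big_split; apply: eq_bigr => i _ /=.
  by rewrite -linearP.
have [h hE] := linear_exists gL; exists h => i u; rewrite hE (gE [:: i])//.
  by rewrite big_seq1 /= singleE.
move=> j /= ji; rewrite inE; apply/eqP; apply: contrapT => ne; apply: ji.
exact: single_ne.
Qed.

Lemma ds_sum_exists (I : Type) (U W : lmodType S) (f : I -> {linear U -> W}) :
  exists g : {linear direct_sum I U -> W}, forall i u, g (ds_single i u) = f i u.
Proof. exact: (@ds_sum_exists_choice {classic I}). Qed.

Lemma ds_decomp (I : Type) (U : lmodType S) (x : direct_sum I U) :
  exists r : seq I, x = \sum_(i <- r) ds_single i (x i).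
Proof.
have /finite_seqP[r rE] := @ds_support {classic I} U x.
exists (undup r); apply: val_inj; apply: funext => i.
rewrite -[RHS]/(ds_eval i _) linear_sum /= /ds_eval /=.
have [xi0|xi0] := pselect (x i = 0).
  rewrite big1 // => j _; have [->|/eqP ji] := eqVneq (j : {classic I}) i.
    by rewrite /= singleE xi0.
  by rewrite /= single_ne // => ij; apply: ji.
have ir : (i : {classic I}) \in undup r.
  by rewrite mem_undup; have : [set` r]%classic i by rewrite -rE.
rewrite (bigD1_seq (i : {classic I})) ?undup_uniq //= singleE big1 ?addr0 //.
by move=> j /eqP ji; rewrite single_ne // => ij; apply: ji.
Qed.

Lemma ds_ext (I : Type) (U W : lmodType S) (f g : {linear direct_sum I U -> W}) :
  (forall i u, f (ds_single i u) = g (ds_single i u)) -> f =1 g.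
Proof.
move=> fg x; have [r ->] := ds_decomp x; rewrite !linear_sum.
by apply: eq_bigr => i _; exact: fg.
Qed.

Definition free (K : Type) : lmodType S := direct_sum K S^o.

Lemma scale_linear (M : lmodType S) (m : M) : linear (fun s : S^o => (s : S) *: m).
Proof. by move=> a s t; rewrite scalerDl scalerA. Qed.

Lemma free_map (K : Type) (M : lmodType S) (v : K -> M) :
  exists f : {linear free K -> M}, forall k, f (ds_single k (1 : S^o)) = v k.
Proof.
have [w wE] := choice (fun k => linear_exists (scale_linear (v k))).
have [f fE] := ds_sum_exists w.
by exists f => k; rewrite fE wE scale1r.
Qed.

Lemma free_ext (K : Type) (M : lmodType S) (f g : {linear free K -> M}) :
  (forall k, f (ds_single k (1 : S^o)) = g (ds_single k (1 : S^o))) -> f =1 g.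
Proof.
move=> fg; apply: ds_ext => k u.
by rewrite -[u]mulr1 -[u * 1]/(u *: (1 : S^o)) !linearZ /= fg.
Qed.

Lemma free_projective (K : Type) : projective_module (free K).
Proof.
move=> A B f g /choice[s sK].
have [h hE] := free_map (fun k => s (g (ds_single k (1 : S^o)))).
exists h; apply: (@free_ext K B (f \o h) g) => k.
by rewrite /= hE sK.
Qed.

Definition free_cover (M : lmodType S) : {linear free M -> M} :=
  projT1 (cid (free_map (fun m : M => m))).

Lemma free_cover_onto (M : lmodType S) x : exists y, free_cover M y = x.
Proof.
rewrite /free_cover; case: cid => f /= fE.
by exists (ds_single x (1 : S^o)); rewrite fE.
Qed.

Definition ker_sub (A B : lmodType S) (f : {linear A -> B}) : submodule A :=
  preim_sub f (zero_sub B).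

Definition syzygy (M : lmodType S) : lmodType S := submod (ker_sub (free_cover M)).

(** [Ext_eq0] quantifies over all resolutions, so a vanishing hypothesis can be exploited only once
    a resolution is at hand. This one iterates the cover of a module by the free module on its
    elements. *)
Lemma projective_resolution_exists (M : lmodType S) : projective_resolution M.
Proof.
pose K n := iter n syzygy M.
pose d n : {linear free (K n.+1) -> free (K n)} :=
  (incl (ker_sub (free_cover (K n))) \o free_cover (K n.+1))%FUN.
apply: (@ProjRes S M (fun n => free (K n)) d (free_cover M)).
- by move=> n; exact: free_projective.
- exact: free_cover_onto.
- move=> x; split=> [x0|[y <-]].
    have [z <-] := @incl_onto _ _ (ker_sub (free_cover M)) x x0.
    by have [y <-] := free_cover_onto z; exists y.
  exact: (inclP (free_cover (K 1%N) y)).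
move=> n x; split=> [/= x0|[y <-]].
  have {}x0 : free_cover (K n.+1) x = 0.
    exact: (inj_eq0 (@incl_inj _ _ (ker_sub (free_cover (K n))))).
  have [z <-] := @incl_onto _ _ (ker_sub (free_cover (K n.+1))) x x0.
  by have [y <-] := free_cover_onto z; exists y.
have /= y0 := inclP (free_cover (K n.+2) y).
by rewrite -[LHS]/(incl _ (free_cover (K n.+1) _)) y0 linear0.
Qed.

End DirectSums.

(** * Finitely generated submodules and noetherian rings *)

Section FinitelyGenerated.
Variable S : pzRingType.

Lemma row_map (M : lmodType S) n (v : 'I_n -> M) :
  exists r : {linear 'rV[S]_n -> M}, forall c, r c = \sum_i c 0 i *: v i.
Proof.
apply: linear_exists => a x y; rewrite scaler_sumr -big_split.
by apply: eq_bigr => i _; rewrite !mxE scalerDl scalerA.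
Qed.

Lemma row_mapE (M : lmodType S) n (r : {linear 'rV[S]_n -> M}) c :
  r c = \sum_i c 0 i *: r (delta_mx 0 i).
Proof.
by rewrite [in LHS](row_sum_delta c) linear_sum; under eq_bigr do rewrite linearZ.
Qed.

(** Chosen preimages of the values at the basis vectors extend linearly; [f] only has to reach the
    image of [g]. *)
Lemma row_lift (A B : lmodType S) n (f : {linear A -> B}) (g : {linear 'rV[S]_n -> B}) :
  (forall c, exists a, f a = g c) ->
  exists h : {linear 'rV[S]_n -> A}, forall c, f (h c) = g c.
Proof.
move=> /choice[s sE]; have [h hE] := row_map (fun i => s (delta_mx 0 i)).
exists h => c; rewrite hE linear_sum [RHS]row_mapE.
by apply: eq_bigr => i _; rewrite linearZ /= sE.
Qed.

Lemma finitely_generatedP (M : lmodType S) :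
  finitely_generated M <->
  exists n (r : {linear 'rV[S]_n -> M}), forall x, exists c, r c = x.
Proof.
split=> [[n [v vE]]|[n [r rE]]]; exists n.
  have [r rE] := row_map v; exists r => x; have [c ->] := vE x.
  by exists (\row_i c i); rewrite rE; apply: eq_bigr => i _; rewrite mxE.
exists (fun i => r (delta_mx 0 i)) => x; have [c <-] := rE x.
by exists (c 0); rewrite -row_mapE.
Qed.

Definition fg_sub (M : lmodType S) (P : submodule M) : Prop :=
  exists n (r : {linear 'rV[S]_n -> M}), forall x, P x <-> exists c, r c = x.

Lemma fg_subP (M : lmodType S) (P : submodule M) :
  fg_sub P <-> finitely_generated (submod P).
Proof.
rewrite finitely_generatedP; split=> -[n [r rE]]; exists n.
  have [|h hE] := @corestrict _ _ P _ r; first by move=> x; apply/rE; exists x.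
  exists h => x; have /rE[c cE] := inclP x; exists c.
  by apply: incl_inj; rewrite hE.
exists (incl P \o r)%FUN => x; split=> [/incl_onto[y <-]|[c <-]]; last exact: inclP.
by have [c <-] := rE y; exists c.
Qed.

Lemma fg_range (A B : lmodType S) (f : {linear A -> B}) :
  finitely_generated A -> fg_sub (range_sub f).
Proof.
move=> /finitely_generatedP[n [r rE]]; exists n, (f \o r)%FUN => x.
split=> [[a <-]|[c <-]]; last by exists (r c).
by have [c <-] := rE a; exists c.
Qed.

Lemma fg_onto (A B : lmodType S) (f : {linear A -> B}) :
  finitely_generated A -> (forall b, exists a, f a = b) -> finitely_generated B.
Proof.
move=> /finitely_generatedP[n [r rE]] f_onto; apply/finitely_generatedP.
exists n, (f \o r)%FUN => b.
by have [a <-] := f_onto b; have [c <-] := rE a; exists c.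
Qed.

Lemma fg_row n : finitely_generated ('rV[S]_n).
Proof. by apply/finitely_generatedP; exists n, idfun => x; exists x. Qed.

Lemma fg_image (A B : lmodType S) (f : {linear A -> B}) (P : submodule A) :
  fg_sub P -> fg_sub (image_sub f P).
Proof.
move=> [n [r rE]]; exists n, (f \o r)%FUN => x.
split=> [[a /rE[c <-] <-]|[c <-]]; first by exists c.
by exists (r c) => //; apply/rE; exists c.
Qed.

(** Generators of the image of [P] are lifted into [P] itself by [t]. Subtracting a suitable lift
    from an element of [P] leaves an element of [P] coming from [A], where the preimage has
    generators. *)
Lemma fg_extension (A B C : lmodType S) (f : {linear A -> B}) (g : {linear B -> C})
    (P : submodule B) :
  (forall b, g b = 0 -> exists a, f a = b) ->
  fg_sub (preim_sub f P) -> fg_sub (image_sub g P) -> fg_sub P.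
Proof.
move=> ex [n [r rE]] [m [s sE]].
have [|t tE] := @row_lift (submod P) C m (g \o incl P)%FUN s.
  move=> c; have /sE[x Px <-] : exists c', s c' = s c by exists c.
  by have [y <-] := incl_onto Px; exists y.
pose k : 'rV[S]_(n + m) -> B := fun c => f (r (lsubmx c)) + incl P (t (rsubmx c)).
have kL : linear k.
  by move=> a x y; rewrite /k !linearP /= scalerDr addrACA.
have [h hE] := linear_exists kL; exists (n + m)%N, h => x.
split=> [Px|[c <-]]; last first.
  rewrite hE; apply: subD; last exact: inclP.
  by apply/(rE (r (lsubmx c))); exists (lsubmx c).
have /sE[c cE] : image_sub g P (g x) by exists x.
have [a aE] : exists a, f a = x - incl P (t c).
  by apply: ex; rewrite linearB /= -cE -tE subrr.
have /rE[d dE] : preim_sub f P a by rewrite /= aE; apply: subB => //; exact: inclP.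
exists (row_mx d c); rewrite hE /k row_mxKl row_mxKr dE aE.
by rewrite subrK.
Qed.

Lemma fg_ext (M : lmodType S) (P Q : submodule M) :
  (forall x, P x <-> Q x) -> fg_sub P -> fg_sub Q.
Proof. by move=> PQ [n [r rE]]; exists n, r => x; rewrite -PQ. Qed.

Lemma fg_zero (M : lmodType S) : fg_sub (zero_sub M).
Proof.
have [r rE] := row_map (fun i : 'I_0 => 0 : M); exists 0%N, r => x.
by split=> [->|[c <-]]; [exists 0; exact: linear0 | rewrite /= rE big_ord0].
Qed.

Lemma fg_full (M : lmodType S) : finitely_generated M -> fg_sub (full_sub M).
Proof.
move=> /finitely_generatedP[n [r rE]]; exists n, r => x.
by split=> // _; exact: rE.
Qed.

Lemma fg_add (M : lmodType S) (P Q : submodule M) :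
  fg_sub P -> fg_sub Q -> fg_sub (add_sub P Q).
Proof.
move=> [n [r rE]] [m [s sE]].
pose k : 'rV[S]_(n + m) -> M := fun c => r (lsubmx c) + s (rsubmx c).
have kL : linear k.
  by move=> a x y; rewrite /k !linearP /= scalerDr addrACA.
have [h hE] := linear_exists kL; exists (n + m)%N, h => x; split.
  move=> [_ [_ [/rE[c <-] /sE[d <-] <-]]].
  by exists (row_mx c d); rewrite hE /k row_mxKl row_mxKr.
move=> [c <-]; rewrite hE; exists (r (lsubmx c)), (s (rsubmx c)).
by split=> //; [apply/rE; exists (lsubmx c) | apply/sE; exists (rsubmx c)].
Qed.

Definition cyclic (M : lmodType S) (x : M) : submodule M.
Proof.
exists (fun y => exists a, y = a *: x); split; first by exists 0; rewrite scale0r.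
by move=> a _ _ [b ->] [c ->]; exists (a * b + c); rewrite scalerDl scalerA.
Defined.

Lemma cyclicP (M : lmodType S) (x : M) : cyclic x x.
Proof. by exists 1; rewrite scale1r. Qed.

Lemma fg_cyclic (M : lmodType S) (x : M) : fg_sub (cyclic x).
Proof.
have [r rE] := row_map (fun i : 'I_1 => x); exists 1%N, r => y.
split=> [[a ->]|[c <-]]; last by exists (c 0 0); rewrite rE big_ord1.
by exists (const_mx a); rewrite rE big_ord1 mxE.
Qed.

Lemma add_subl (M : lmodType S) (P Q : submodule M) x : P x -> add_sub P Q x.
Proof. by move=> Px; exists x, 0; rewrite addr0; split=> //; exact: sub0. Qed.
Lemma add_subr (M : lmodType S) (P Q : submodule M) x : Q x -> add_sub P Q x.
Proof. by move=> Qx; exists 0, x; rewrite add0r; split=> //; exact: sub0. Qed.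

Lemma strict_chain (M : lmodType S) (Phi : submodule M -> Prop) (P0 : submodule M) :
  Phi P0 ->
  (forall P, Phi P -> exists P' : submodule M,
     [/\ Phi P', forall x, P x -> P' x & exists2 x, P' x & ~ P x]) ->
  exists P : nat -> submodule M, forall n,
    [/\ Phi (P n), forall x, P n x -> P n.+1 x & exists2 x, P n.+1 x & ~ P n x].
Proof.
move=> Phi0 step.
have next (p : {P | Phi P}) : exists q : {P | Phi P},
    (forall x, sval p x -> sval q x) /\ exists2 x, sval q x & ~ sval p x.
  case: p => P PhiP; have [P' [PhiP' PP' xP']] := step P PhiP.
  by exists (exist _ P' PhiP').
have [f [_ fE]] := dependent_choice (fun p => cid (next p)) (exist _ P0 Phi0).
exists (fun n => sval (f n)) => n; have [fsub fx] := fE n; split=> //.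
exact: svalP (f n).
Qed.

Lemma short_exact_quot (M : lmodType S) (D : submodule M) :
  short_exact (incl D) (proj D).
Proof.
split=> [|x|]; [exact: incl_inj | rewrite proj_eq0 | exact: proj_onto].
by split=> [/incl_onto//|[y <-]]; exact: inclP.
Qed.

Lemma fg_preim (A B C : lmodType S) (f : {linear A -> B}) (g : {linear B -> C})
    (P : submodule C) :
  short_exact f g -> finitely_generated A -> fg_sub P -> fg_sub (preim_sub g P).
Proof.
move=> [fI ex g_onto] fgA fgP; apply: (@fg_extension _ _ _ f g) => [b /ex//||].
  apply: fg_ext (fg_full fgA) => x; split=> //= _.
  by rewrite (ex _).2; [exact: sub0 | exists x].
apply: fg_ext fgP => y; split=> [Py|[x /= Px <-//]].
by have [x xE] := g_onto y; exists x; rewrite //= xE.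
Qed.

Definition directed (M : lmodType S) (DD : submodule M -> Prop) : Prop :=
  (exists D, DD D) /\
  forall D E, DD D -> DD E -> exists D' : submodule M,
    [/\ DD D', forall x, D x -> D' x & forall x, E x -> D' x].

Lemma fg_directed (M : lmodType S) (DD : submodule M -> Prop) (L : submodule M) :
  directed DD -> fg_sub L -> (forall x, L x -> exists2 D : submodule M, DD D & D x) ->
  exists2 D : submodule M, DD D & forall x, L x -> D x.
Proof.
move=> [DD0 dirD] [n [r rE]] LD.
have H (s : seq M) : (forall x, x \in s -> L x) ->
    exists2 D : submodule M, DD D & forall x, x \in s -> D x.
  elim: s => [_|x s IHs xs]; first by have [D DDD] := DD0; exists D.
  have [|D DDD sD] := IHs; first by move=> y ys; apply: xs; rewrite inE ys orbT.
  have [E DDE Ex] := LD x (xs x (mem_head _ _)).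
  have [D' [DD' DD'1 ED']] := dirD _ _ DDD DDE; exists D' => // y.
  by rewrite inE => /orP[/eqP->|/sD]; [exact: ED' | exact: DD'1].
have [|D DDD rD] := H [seq r (delta_mx 0 i) | i <- enum 'I_n].
  by move=> x /mapP[i _ ->]; apply/rE; exists (delta_mx 0 i).
exists D => // x /rE[c <-]; rewrite row_mapE; apply: sub_sum => i _.
by apply/subZ/rD/map_f; rewrite mem_enum.
Qed.

Section Noetherian.
Hypothesis noethS : noetherian_module S^o.

(** Adjoining one missing element at a time to finitely generated submodules of [P] would give a
    strict chain. *)
Lemma noetherian_regular (P : submodule S^o) : fg_sub P.
Proof.
apply: contrapT => nP.
pose Phi (Q : submodule S^o) := fg_sub Q /\ forall x, Q x -> P x.
have [|Q [fgQ QP]|Q QE] := @strict_chain _ Phi (zero_sub _).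
- by split=> [|x ->]; [exact: fg_zero | exact: sub0].
- have [x /not_implyP[Px nQx]] : exists x, ~ (P x -> Q x).
    apply/existsNP => PQ; apply: nP; apply: fg_ext fgQ => x.
    by split; [exact: QP | exact: PQ].
  exists (add_sub Q (cyclic x)); split.
  + split; first exact/fg_add/fg_cyclic.
    by move=> _ [y [_ [Qy [a ->] <-]]]; apply: subD; [exact: QP | exact: subZ].
  + by move=> y; exact: add_subl.
  by exists x => //; apply: add_subr; exact: cyclicP.
have [|n x|n nE] := noethS (I := fun n => submodule_pred (Q n)).
- by move=> n; exact: submodule_pred_closed.
- by have [_ QS _] := QE n; move=> /asboolP/QS ?; exact/asboolP.
have [_ _ [x Qx]] := QE n; apply.
have := nE n.+1 (leqnSn n) x; rewrite -!topredE /= /submodule_pred.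
by rewrite (asboolT Qx) => /esym/asboolP.
Qed.

(** Induction along 0 -> S^n -> S^(n+1) -> S -> 0, the last map being the coordinate of index 0. *)
Lemma noetherian_row n (P : submodule 'rV[S]_n) : fg_sub P.
Proof.
elim: n P => [|n IHn] P.
  apply: fg_ext (fg_zero _) => x; have -> : x = 0 by apply/rowP; case.
  by split=> // _; exact: sub0.
pose f (c : 'rV[S]_n) : 'rV[S]_n.+1 :=
  \row_j oapp (c 0) 0 (unlift ord0 j).
have [|f' f'E] := @linear_exists _ _ _ f.
  move=> a x y; apply/rowP => j; rewrite !mxE.
  by case: unliftP => [k _|_] /=; rewrite ?mxE // mulr0 addr0.
have [|g gE] := @linear_exists _ _ _ (fun c : 'rV[S]_n.+1 => c 0 0 : S^o).
  by move=> a x y; rewrite !mxE.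
apply: (@fg_extension _ _ _ f' g) => //; last exact: noetherian_regular.
move=> b; rewrite gE => b0; exists (\row_k b 0 (lift ord0 k)).
rewrite f'E; apply/rowP => j; rewrite !mxE.
by case: unliftP => [k ->|->] /=; rewrite ?mxE.
Qed.

End Noetherian.
End FinitelyGenerated.

(** * Torsion pairs and the finitely generated torsion part *)

Section TorsionPairs.
Variables (S : pzRingType) (X Y : lmodType S -> Prop).
Hypothesis XY : torsion_pair X Y.

Lemma torsion_hom0 (M N : lmodType S) (f : {linear M -> N}) x : X M -> Y N -> f x = 0.
Proof. by move=> XM YN; have /XY.1 := XM; apply. Qed.

Lemma torsion_free_sub (M N : lmodType S) (f : {linear M -> N}) :
  injective f -> Y N -> Y M.
Proof.
move=> fI YN; apply/XY.2 => Z g XZ z; apply: inj_eq0 fI _.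
exact: (@torsion_hom0 Z N (f \o g)%FUN).
Qed.

Lemma torsion_free_product (M : lmodType S) (I : Type) (N : I -> lmodType S)
    (f : forall i, {linear M -> N i}) :
  (forall x, (forall i, f i x = 0) -> x = 0) -> (forall i, Y (N i)) -> Y M.
Proof.
move=> f0 YN; apply/XY.2 => Z g XZ z; apply: f0 => i.
exact: (@torsion_hom0 Z (N i) (f i \o g)%FUN).
Qed.

(** A map to a module in [Y] vanishes on both summands. Two sources serve for sums of submodules; a
    zero second summand serves for quotients and directed unions. *)
Lemma torsion_sum (M : lmodType S) :
  (forall x, exists (Z W : lmodType S) (f : {linear Z -> M}) (g : {linear W -> M}) z w,
     [/\ X Z, X W & x = f z + g w]) -> X M.
Proof.
move=> H; apply/XY.1 => N h YN x; have [Z [W [f [g [z [w [XZ XW ->]]]]]]] := H x.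
rewrite linearD -[h (f z)]/((h \o f)%FUN z) -[h (g w)]/((h \o g)%FUN w).
by rewrite !torsion_hom0 // addr0.
Qed.

Lemma torsion_quotient (M N : lmodType S) (f : {linear M -> N}) :
  (forall y, exists x, f x = y) -> X M -> X N.
Proof.
move=> f_onto XM; apply: torsion_sum => y; have [x <-] := f_onto y.
by exists M, M, f, f, x, 0; rewrite linear0 addr0.
Qed.

Lemma torsion_and_free (M : lmodType S) (x : M) : X M -> Y M -> x = 0.
Proof. exact: (@torsion_hom0 M M idfun). Qed.

Lemma not_torsion_free (N : lmodType S) :
  ~ Y N -> exists (Z : lmodType S) (f : {linear Z -> N}), X Z /\ exists z, f z <> 0.
Proof.
move=> nY; apply: contrapT => nH; apply: nY; apply/XY.2 => Z f XZ z.
by apply: contrapT => fz; apply: nH; exists Z, f; split=> //; exists z.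
Qed.

Lemma torsion_add (M : lmodType S) (P Q : submodule M) :
  X (submod P) -> X (submod Q) -> X (submod (add_sub P Q)).
Proof.
move=> XP XQ; apply: torsion_sum => x.
have [f fE] := incl_le (@add_subl S M P Q).
have [g gE] := incl_le (@add_subr S M P Q).
have [_ [_ [/incl_onto[y <-] /incl_onto[z <-] xE]]] := inclP x.
exists (submod P), (submod Q), f, g, y, z; split=> //.
by apply: incl_inj; rewrite linearD /= fE gE xE.
Qed.

Definition locally_torsion_free (C : lmodType S) : Prop :=
  forall (N : lmodType S) (f : {linear N -> C}),
    finitely_generated N -> injective f -> Y N.

Lemma locally_torsion_free_sub (C D : lmodType S) (f : {linear D -> C}) :
  injective f -> locally_torsion_free C -> locally_torsion_free D.
Proof.
move=> fI locC N g fgN gI; apply: (locC N (f \o g)%FUN) => //.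
exact: inj_comp.
Qed.

(** In general this is smaller than the torsion submodule: for the class of divisible abelian groups
    it is zero. *)
Definition tau (M : lmodType S) : submodule M.
Proof.
exists (fun x => exists P : submodule M, [/\ fg_sub P, X (submod P) & P x]); split.
  exists (zero_sub M); split=> //; first exact: fg_zero.
  apply/XY.1 => N f _ x; suff -> : x = 0 by exact: linear0.
  by apply: incl_inj; rewrite linear0; exact: (inclP x).
move=> a x y [P [fgP XP Px]] [Q [fgQ XQ Qy]]; exists (add_sub P Q).
split; [exact: fg_add | exact: torsion_add |].
by apply: subL; [exact: add_subl | exact: add_subr].
Defined.

Lemma tau_sup (M : lmodType S) (P : submodule M) x :
  fg_sub P -> X (submod P) -> P x -> tau M x.
Proof. by exists P. Qed.

Lemma tau_directed (M : lmodType S) (L : submodule M) :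
  fg_sub L -> (forall x, L x -> tau M x) ->
  exists P : submodule M, [/\ fg_sub P, X (submod P) & forall x, L x -> P x].
Proof.
move=> fgL Ltau.
have [||P [fgP XP] LP] :=
    @fg_directed S M (fun P => fg_sub P /\ X (submod P)) L _ fgL.
- split; first by have [P [fgP XP _]] := sub0 (tau M); exists P.
  move=> P Q [fgP XP] [fgQ XQ]; exists (add_sub P Q); split.
  + by split; [exact: fg_add | exact: torsion_add].
  + by move=> x; exact: add_subl.
  + by move=> x; exact: add_subr.
- by move=> x /Ltau[P [fgP XP Px]]; exists P.
by exists P.
Qed.

Lemma tau_chain (M : lmodType S) : ~ fg_sub (tau M) ->
  exists P : nat -> submodule M, forall n,
    [/\ fg_sub (P n) /\ X (submod (P n)), forall x, P n x -> P n.+1 x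
      & exists2 x, P n.+1 x & ~ P n x].
Proof.
move=> ntau; have [P0 [fgP0 XP0 _]] := sub0 (tau M).
apply: (@strict_chain S M (fun P => fg_sub P /\ X (submod P)) P0) => // P [fgP XP].
have [x /not_implyP[[Q [fgQ XQ Qx]] nPx]] : exists x, ~ (tau M x -> P x).
  apply/existsNP => tauP; apply: ntau; apply: (fg_ext _ fgP) => x.
  by split; [exact: (tau_sup fgP XP) | exact: tauP].
exists (add_sub P Q); split.
- by split; [exact: fg_add | exact: torsion_add].
- by move=> y; exact: add_subl.
by exists x => //; exact: add_subr.
Qed.

(** By noetherianity the relations of [N], lifted to [M], fall into one finitely generated torsion
    submodule [P]. Adding to [P] the lift of a torsion image in [N] keeps it finitely generated and
    torsion, so that lift lies in [tau M] and the image is zero. *)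
Lemma tau_locally (M : lmodType S) : noetherian_module S^o ->
  locally_torsion_free (quot (tau M)).
Proof.
move=> noethS N f fgN fI; apply: contrapT => /not_torsion_free[Z [phi [XZ [z0]]]].
apply; have /finitely_generatedP[n [r r_onto]] := fgN.
have [|s sE] := @row_lift _ _ _ _ (proj (tau M)) (f \o r)%FUN.
  by move=> c; exact: proj_onto.
pose K := preim_sub r (range_sub phi).
have sK0 c : r c = 0 -> tau M (s c).
  by move=> rc; apply/proj_eq0; rewrite sE /= rc linear0.
have [||P [fgP XP LP]] := @tau_directed M (image_sub s (ker_sub r)).
- exact/fg_image/noetherian_row.
- by move=> _ [c rc <-]; exact: sK0.
pose P' := add_sub P (image_sub s K).
(* A map [psi] to a module in [Y] kills [P]. What is left of it on [K] kills the relations, so it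
   factors through the image of [phi], which is torsion. *)
have XP' : X (submod P').
  apply/XY.1 => W psi YW x.
  have [i iE] := incl_le (@add_subl S M P (image_sub s K)).
  have [|j jE] := @corestrict _ _ P' _ (s \o incl K)%FUN.
    by move=> c; apply: add_subr; exists (incl K c) => //; exact: inclP.
  have [|q qE] := @corestrict _ _ (range_sub phi) _ (r \o incl K)%FUN.
    by move=> c; exact: (inclP c).
  have psiP y : P (incl P' y) -> psi y = 0.
    move=> /incl_onto[z zE]; have -> : y = i z by apply: incl_inj; rewrite iE zE.
    exact: (@torsion_hom0 _ _ (psi \o i)%FUN).
  have [||h hE] := @factor_onto _ _ _ _ q (psi \o j)%FUN.
  - move=> y; have [c cE] := r_onto (incl _ y).
    have /incl_onto[d dE] : K c by rewrite /= cE; exact: (inclP y).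
    by exists d; apply: incl_inj; rewrite qE /= dE cE.
  - move=> c qc; apply: psiP; rewrite jE; apply: LP; exists (incl K c) => //=.
    by rewrite -[LHS]qE qc linear0.
  have Xphi : X (submod (range_sub phi)).
    have [|p pE] := @corestrict _ _ (range_sub phi) _ phi; first by move=> z; exists z.
    apply: (torsion_quotient (f := p)) XZ => y.
    by have [z zE] := inclP y; exists z; apply: incl_inj; rewrite pE.
  have [y [_ [Py [_ /incl_onto[d <-] <-] xE]]] := inclP x.
  have [z zE] := incl_onto Py.
  have -> : x = i z + j d by apply: incl_inj; rewrite linearD /= iE jE zE xE.
  rewrite linearD /= psiP ?iE ?zE // -[psi (j d)]/((psi \o j)%FUN d) -hE.
  by rewrite torsion_hom0 // addr0.
have fgP' : fg_sub P' by apply/fg_add/fg_image/noetherian_row.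
have [c cE] := r_onto (phi z0); rewrite -cE.
have : tau M (s c).
  apply: (tau_sup fgP' XP'); apply: add_subr; exists c => //.
  by exists z0.
by move=> /proj_eq0; rewrite sE /= => /(inj_eq0 fI).
Qed.

End TorsionPairs.

(** * Vanishing of [Ext] through an injective coresolution *)

Section Extensions.
Variable S : pzRingType.

(* Ext^1(C, W) = 0 in Yoneda form. *)
Definition ext1_zero (C W : lmodType S) : Prop :=
  forall (A B : lmodType S) (i : {linear A -> B}) (g : {linear B -> C})
    (u : {linear A -> W}),
  short_exact i g -> exists h : {linear B -> W}, forall a, h (i a) = u a.

Lemma injective_extend (E A B : lmodType S) (d : {linear A -> B})
    (f : {linear A -> E}) :
  injective_module E -> (forall a, d a = 0 -> f a = 0) ->
  exists h : {linear B -> E}, forall a, h (d a) = f a.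
Proof.
move=> injE df.
have [|d' d'E] := @corestrict _ _ (range_sub d) _ d; first by move=> a; exists a.
have [||f' f'E] := @factor_onto _ _ _ _ d' f.
- by move=> y; have [a aE] := inclP y; exists a; apply: incl_inj; rewrite d'E.
- by move=> a d'a; apply: df; rewrite -d'E d'a linear0.
have [h hE] := injE _ _ _ f' (@incl_inj _ _ (range_sub d)).
by exists h => a; rewrite -d'E hE f'E.
Qed.

Variables (U E0 E1 : lmodType S) (io : {linear U -> E0}) (pi : {linear E0 -> E1}).
Hypothesis io_pi : short_exact io pi.
Hypotheses (injE0 : injective_module E0) (injE1 : injective_module E1).

(** For an injective coresolution of [U] this is Ext^1(M, U) = 0, by exactness of Hom(M, E0) ->
    Hom(M, E1) -> Ext^1(M, U) -> 0. *)
Definition lifts (M : lmodType S) : Prop :=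
  forall xi : {linear M -> E1}, exists eta : {linear M -> E0},
    forall x, pi (eta x) = xi x.

Lemma lift_to_U (A : lmodType S) (f : {linear A -> E0}) :
  (forall a, pi (f a) = 0) -> exists h : {linear A -> U}, forall a, io (h a) = f a.
Proof.
case: io_pi => ioI ex _ pif; apply: lift_inj => // a.
by have [+ _] := ex (f a); apply.
Qed.

Lemma pi_io u : pi (io u) = 0.
Proof. by case: io_pi => _ ex _; apply/ex; exists u. Qed.

Lemma linear_sub_exists (A B : lmodType S) (f g : {linear A -> B}) :
  exists h : {linear A -> B}, forall a, h a = f a - g a.
Proof.
by apply: linear_exists => a x y; rewrite !linearP scalerDr addrACA.
Qed.

(** A lift of [xi] to the start of a resolution, composed with [d 0], is a 1-cocycle with values in
    [U]. Subtracting a cochain that bounds it gives a map that descends to [M]. *)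
Lemma Ext1_lifts (M : lmodType S) : Ext_eq0 1 M U -> lifts M.
Proof.
have [ioI ex pi_onto] := io_pi; move=> ExtM xi.
have P := projective_resolution_exists M; have := ExtM P.
case: P => P d aug projP aug_onto augd dd /= {}ExtM.
have [a aE] := projP 0%N _ _ pi (xi \o aug)%FUN pi_onto.
have augd0 x : aug (d 0 x) = 0 by apply/augd; exists x.
have dd0 x : d 0 (d 1 x) = 0 by apply/(dd 0%N); exists x.
have [|f fE] := @lift_to_U _ (a \o d 0%N)%FUN.
  by move=> x; rewrite /= aE /= augd0 linear0.
have [|g gE] := ExtM f.
  by move=> x; apply: (inj_eq0 ioI); rewrite fE /= dd0 linear0.
have [b bE] := linear_sub_exists a (io \o g)%FUN.
have [|eta etaE] := @factor_onto _ _ _ _ aug b aug_onto.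
  by move=> x /augd[y <-]; rewrite bE /= -gE fE subrr.
exists eta => x; have [y <-] := aug_onto x.
by rewrite etaE bE linearB /= pi_io subr0 aE.
Qed.

(** The cocycle extends along the differential to a map [a] into [E0]. Subtracting a map [b] with
    the same image in [E1] that vanishes on the range of [d j] turns [a] into a bounding cochain
    with values in [U]. *)
Lemma lifts_Ext (M : lmodType S) j : lifts M -> (0 < j)%N -> Ext_eq0 j M U.
Proof.
have [ioI ex pi_onto] := io_pi; move=> liftM j0 P; case: j j0 => // j _.
case: P => P d aug projP aug_onto augd dd /= f fd.
have augd0 x : aug (d 0 x) = 0 by apply/augd; exists x.
have dd0 n x : d n (d n.+1 x) = 0 by apply/dd; exists x.
have [|a aE] := @injective_extend _ _ _ (d j) (io \o f)%FUN injE0.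
  by move=> x /dd[y <-]; rewrite /= fd linear0.
suff [b [bd bE]] : exists b : {linear P j -> E0},
    (forall x, b (d j x) = 0) /\ forall x, pi (b x) = pi (a x).
  have [c cE] := linear_sub_exists a b.
  have [|g gE] := @lift_to_U _ c; first by move=> x; rewrite cE linearB /= bE subrr.
  by exists g => x; apply: ioI; rewrite gE cE bd subr0 aE.
have piad x : pi (a (d j x)) = 0 by rewrite aE /= pi_io.
(* In degree 1, [pi a] descends to [M] and lifts there. In higher degrees it factors through the
   preceding differential since [E1] is injective, and then lifts by projectivity. *)
case: j f fd a aE piad => [|j] f fd a aE piad.
  have [|xi xiE] := @factor_onto _ _ _ _ aug (pi \o a)%FUN aug_onto.
    by move=> x /augd[y <-]; exact: piad.
  have [eta etaE] := liftM xi; exists (eta \o aug)%FUN; split=> x /=.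
    by rewrite augd0 linear0.
  by rewrite etaE xiE.
have [|b bE] := @injective_extend _ _ _ (d j) (pi \o a)%FUN injE1.
  by move=> x /dd[y <-]; exact: piad.
have [b' b'E] := projP j _ _ pi b pi_onto.
exists (b' \o d j)%FUN; split=> x /=; first by rewrite dd0 linear0.
by rewrite b'E bE.
Qed.

(** Extend [u] to a map from [B] to [E0], then subtract a lift of the map it induces from [C] to
    [E1]. *)
Lemma lifts_ext1_zero (C : lmodType S) : lifts C -> ext1_zero C U.
Proof.
move=> liftC A B i g u [iI ex g_onto].
have [h0 h0E] := injE0 (io \o u)%FUN iI.
have [|xi xiE] := @factor_onto _ _ _ _ g (pi \o h0)%FUN g_onto.
  by move=> b /ex[a <-]; rewrite /= h0E /= pi_io.
have [eta etaE] := liftC xi.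
have [h1 h1E] := linear_sub_exists h0 (eta \o g)%FUN.
have [|h hE] := @lift_to_U _ h1.
  by move=> b; rewrite h1E linearB /= etaE xiE subrr.
exists h => a; have [ioI _ _] := io_pi; apply: ioI.
have /ex gi : exists a', i a' = i a by exists a.
by rewrite hE h1E /= gi linear0 subr0 h0E.
Qed.

(* P is the pullback of U -> E0 -> E1 along xi. *)
Lemma lifts_of_pullback (C : lmodType S) (xi : {linear C -> E1}) :
  exists (P : lmodType S) (j : {linear U -> P}) (q : {linear P -> C}),
  [/\ short_exact j q,
      forall (F : lmodType S) (h : {linear F -> C}) (eta : {linear F -> E0}),
        (forall x, pi (eta x) = xi (h x)) ->
        exists k : {linear F -> P}, forall x, q (k x) = h x
    & (exists r : {linear P -> U}, forall u, r (j u) = u) ->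
      exists eta : {linear C -> E0}, forall x, pi (eta x) = xi x].
Proof.
have [ioI ex pi_onto] := io_pi.
have [G GE] : exists G : submodule (E0 * C)%type,
    forall e c, G (e, c) <-> pi e = xi c.
  have [|G0 G0E] := @linear_exists _ (E0 * C)%type E1 (fun z => pi z.1 - xi z.2).
    move=> a x y /=.
    by rewrite !linearP scalerDr addrACA.
  exists (ker_sub G0) => e c /=; rewrite G0E /=.
  by split=> [/subr0_eq|->]; rewrite ?subrr.
have [fstL fstLE] := @linear_exists _ (E0 * C)%type E0 fst (fun _ _ _ => erefl).
have [sndL sndLE] := @linear_exists _ (E0 * C)%type C snd (fun _ _ _ => erefl).
have GP (x : submod G) : pi (fstL (incl G x)) = xi (sndL (incl G x)).
  by rewrite fstLE sndLE; apply/GE; rewrite -surjective_pairing; exact: inclP.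
have [|j0 j0E] := @linear_exists _ U (E0 * C)%type (fun u => (io u, 0)).
  by move=> a x y; rewrite linearP [RHS]surjective_pairing /= scaler0 addr0.
have [|j jE] := @corestrict _ _ G _ j0.
  by move=> u; rewrite j0E; apply/GE; rewrite pi_io linear0.
exists (submod G), j, (sndL \o incl G)%FUN; split.
- split=> [|b|c].
  + apply: linear_inj0 => u ju; apply: (inj_eq0 ioI).
    by rewrite -[io u]/(io u, 0 : C).1 -j0E -jE ju linear0.
  + split=> /= [b0|[u <-]]; last by rewrite sndLE jE j0E.
    have [+ _] := ex (fstL (incl G b)).
    rewrite GP b0 linear0 => /(_ erefl)[u uE]; exists u; apply: incl_inj.
    by rewrite jE j0E uE -b0 fstLE sndLE -surjective_pairing.
  + have [e eE] := pi_onto (xi c).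
    have [y yE] := incl_onto ((GE e c).2 eE).
    by exists y; rewrite /= yE sndLE.
- move=> F h eta etaE.
  have [|k0 k0E] := @linear_exists _ F (E0 * C)%type (fun x => (eta x, h x)).
    by move=> a x y; rewrite !linearP.
  have [|k kE] := @corestrict _ _ G _ k0; first by move=> x; rewrite k0E; apply/GE.
  by exists k => x; rewrite /= kE k0E sndLE.
move=> [r rE].
(* With a retraction [r], subtracting [io r] from the [E0]-coordinate kills the copy of [U], so the
   difference descends to [C]. *)
have [f fE] := linear_sub_exists (fstL \o incl G)%FUN (io \o r)%FUN.
have [||eta etaE] := @factor_onto _ _ _ _ (sndL \o incl G)%FUN f.
- move=> c; have [e eE] := pi_onto (xi c).
  have [y yE] := incl_onto ((GE e c).2 eE).
  by exists y; rewrite /= yE sndLE.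
- move=> b /= b0; have [+ _] := ex (fstL (incl G b)).
  rewrite GP b0 linear0 => /(_ erefl)[u uE].
  have -> : b = j u.
    by apply: incl_inj; rewrite jE j0E uE -b0 fstLE sndLE -surjective_pairing.
  by rewrite fE /= rE jE j0E fstLE subrr.
exists eta => c; have [e eE] := pi_onto (xi c).
have [y yE] := incl_onto ((GE e c).2 eE).
have -> : c = (sndL \o incl G)%FUN y by rewrite /= yE sndLE.
by rewrite etaE fE linearB /= pi_io subr0 GP.
Qed.

Lemma ext1_zero_lifts (C : lmodType S) : ext1_zero C U -> lifts C.
Proof.
move=> extC xi; have [P [j [q [ex _]]]] := lifts_of_pullback xi; apply.
exact: extC idfun ex.
Qed.

(** This is exactness of Hom(B, U) -> Hom(A, U) -> Ext^1(C, U) -> Ext^1(B, U). *)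
Lemma lifts_quotient (A B C : lmodType S) (i : {linear A -> B}) (g : {linear B -> C}) :
  short_exact i g -> lifts B ->
  (forall u : {linear A -> U}, exists h : {linear B -> U}, forall a, h (i a) = u a) ->
  lifts C.
Proof.
move=> [iI ex g_onto] liftB extA xi.
have [b bE] := liftB (xi \o g)%FUN.
have gi a : g (i a) = 0 by apply/ex; exists a.
have [|u uE] := @lift_to_U _ (b \o i)%FUN.
  by move=> a; rewrite /= bE /= gi linear0.
have [h hE] := extA u.
have [c cE] := linear_sub_exists b (io \o h)%FUN.
have [|eta etaE] := @factor_onto _ _ _ _ g c g_onto.
  by move=> x /ex[a <-]; rewrite cE /= hE uE subrr.
exists eta => x; have [y <-] := g_onto x.
by rewrite etaE cE linearB /= pi_io subr0 bE.
Qed.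

End Extensions.

(** * Pure-injectivity, and the Reiten-Ringel condition from Sigma-pure-injectivity *)

Section PureInjective.
Variable S : pzRingType.

(** The function is total on [M] but constrained only on [D], so it can be restricted along a chain
    of submodules without changing type. *)
Definition linear_on (M N : lmodType S) (D : submodule M) (phi : M -> N) : Prop :=
  forall a x y, D x -> D y -> phi (a *: x + y) = a *: phi x + phi y.

Lemma linear_on_exists (M N : lmodType S) (D : submodule M)
    (u : {linear submod D -> N}) :
  exists2 phi : M -> N, linear_on D phi & forall x, phi (incl D x) = u x.
Proof.
have /choice[s sE] (x : M) : exists y : submod D, D x -> incl D y = x.
  have [/incl_onto[y yE]|nDx] := pselect (D x); first by exists y.
  by exists 0.
have uE x : u (s (incl D x)) = u x.
  by congr (u _); apply: incl_inj; apply: sE; exact: inclP.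
exists (fun x => u (s x)) => // a x y /incl_onto[x' <-] /incl_onto[y' <-].
by rewrite -linearP !uE linearP.
Qed.

Lemma linear_on_restrict (M N : lmodType S) (D : submodule M) (phi : M -> N) :
  linear_on D phi -> exists u : {linear submod D -> N}, forall x, u x = phi (incl D x).
Proof.
by move=> phiL; apply: linear_exists => a x y; rewrite linearP phiL //; exact: inclP.
Qed.

Lemma linear_on_sub (M N : lmodType S) (D D' : submodule M) (phi : M -> N) :
  (forall x, D x -> D' x) -> linear_on D' phi -> linear_on D phi.
Proof. by move=> DD' phiL a x y /DD' Dx /DD' Dy; exact: phiL. Qed.

Lemma finitely_presented_fg (F : lmodType S) :
  finitely_presented F -> finitely_generated F.
Proof.
by move=> [m [n [_ [p [p_onto _]]]]]; apply: fg_onto p_onto; exact: fg_row.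
Qed.

(* A map out of a finitely presented module meets only finitely many relations,
   so it lifts from U^I / U^(I) to U^I after erasing finitely many coordinates. *)
Lemma direct_sum_pure (I : Type) (U : lmodType S) :
  pure_exact (ds_val I U) (proj (range_sub (ds_val I U))).
Proof.
set T := range_sub _; split.
  split=> [x y /val_inj //|x|c]; [exact: proj_eq0 | exact: proj_onto].
move=> F h [m [n [r [p [p_onto pr]]]]].
have [|s sE] := @row_lift _ _ _ _ (proj T) (h \o p)%FUN.
  by move=> c; exact: proj_onto.
have sr z : T (s (r z)).
  by apply/proj_eq0; rewrite sE /= (pr _).2 ?linear0 //; exists z.
pose J : set I :=
  (\bigcup_(i in [set: 'I_m]) [set t | s (r (delta_mx 0 i)) t <> 0])%classic.
have finJ : finite_set J.
  apply: bigcup_finite => [|i _]; first exact: finite_finset.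
  by have [x <-] := sr (delta_mx 0 i); exact: ds_support.
pose k (x : I -> U) : I -> U := fun t => if `[< J t >] then 0 else x t.
have [|k' k'E] := @linear_exists _ _ _ k.
  move=> a x y; apply: funext => t; rewrite -[RHS]/(a *: k x t + k y t) /k.
  by case: ifP => // _; rewrite scaler0 addr0.
have ksr z : k (s (r z)) = 0.
  apply: funext => t; rewrite /k; case: asboolP => // nJt.
  rewrite [r z]row_mapE linear_sum fct_sumE big1 // => i _.
  rewrite linearZ -[LHS]/(_ *: s (r (delta_mx 0 i)) t).
  suff -> : s (r (delta_mx 0 i)) t = 0 by rewrite scaler0.
  by apply: contrapT => st; apply: nJt; exists i.
have [|q qE] := @factor_onto _ _ _ _ p (k' \o s)%FUN p_onto.
  by move=> c /pr[z <-]; rewrite /= k'E ksr.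
exists q => x; have [c <-] := p_onto x.
rewrite qE /= k'E -[RHS]sE; apply/esym/subr0_eq; rewrite -linearB; apply/proj_eq0.
have fs : (s c - k (s c)) \in @Defs.finite_support S I U.
  apply/asboolP; apply: sub_finite_set finJ => t /= st.
  apply: contrapT => nJt; apply: st.
  by rewrite -[LHS]/(s c t - k (s c) t) /k asboolF // subrr.
by exists (DirectSum fs).
Qed.

Lemma direct_sum_retract (I : Type) (U : lmodType S) :
  pure_injective (direct_sum I U) ->
  exists p : {linear (I -> U) -> direct_sum I U}, forall x, p (ds_val I U x) = x.
Proof. by move=> pinj; exact: (pinj _ _ _ _ _ idfun (direct_sum_pure I U)). Qed.

Lemma Sigma_pure_injectiveW (U : lmodType S) :
  Sigma_pure_injective U -> pure_injective U.
Proof.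
move=> SU A B C f g u pe.
have [h hE] := SU unit _ _ _ _ _ (ds_single tt \o u)%FUN pe.
exists (ds_eval tt \o h)%FUN => a.
by rewrite /= hE /= /ds_eval /= singleE.
Qed.

Variables (X Y : lmodType S -> Prop) (U E0 E1 : lmodType S).
Variables (io : {linear U -> E0}) (pi : {linear E0 -> E1}).
Hypothesis XY : torsion_pair X Y.
Hypothesis io_pi : short_exact io pi.
Hypothesis YE : forall M, Y M <-> lifts pi M.
Hypothesis YU : Y U.

(** The pullback extension of [C] by [U] is pure: the image in [C] of a finitely presented module
    lies in [Y], so the map lifts. Pure-injectivity splits the extension, which lifts [xi]. *)
Lemma pure_injective_locally (C : lmodType S) :
  pure_injective U -> locally_torsion_free Y C -> Y C.
Proof.
move=> pinjU locC; apply/YE => xi.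
have [P [j [q [ex liftP retractP]]]] := lifts_of_pullback io_pi xi.
apply: retractP; apply: (pinjU _ _ _ j q idfun); split=> // F h fpF.
have YN : Y (submod (range_sub h)).
  apply: (locC _ (incl _)); last exact: incl_inj.
  by apply/fg_subP/fg_range/finitely_presented_fg.
have [|h' h'E] := @corestrict _ _ (range_sub h) _ h; first by move=> x; exists x.
have [eta etaE] := (YE _).1 YN (xi \o incl _)%FUN.
by apply: (liftP F h (eta \o h')%FUN) => x; rewrite /= etaE /= h'E.
Qed.

(* If f_n : T_n -> U does not extend to T_{n+1}, a retraction p of U^N onto U^(N)
   maps (f_n)_n on T_0 to a finitely supported family; at a coordinate k outside
   all the supports, this makes f_k extend to T_{k+1}. *)
Lemma retract_chain_false (N Q : lmodType S) (g : {linear N -> Q})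
    (P : nat -> submodule Q) (p : {linear (nat -> U) -> direct_sum nat U}) :
  (forall x, p (ds_val nat U x) = x) -> Y N -> (forall y, exists x, g x = y) ->
  fg_sub (preim_sub g (P 0%N)) ->
  (forall n, [/\ X (submod (P n)), forall x, P n x -> P n.+1 x
               & exists2 x, P n.+1 x & ~ P n x]) -> False.
Proof.
move=> pK YN g_onto fgT0 chainP.
pose T n := preim_sub g (P n).
have PS m n : (m <= n)%N -> forall x, P m x -> P n x.
  move=> /subnK<-; elim: (n - m)%N => // d IHd x /IHd.
  by have [_ + _] := chainP (d + m)%N; apply.
have TS m n : (m <= n)%N -> forall x, T m x -> T n x by move=> mn x; exact: PS.
have gT n : exists g' : {linear submod (T n) -> submod (P n)},
    (forall x, incl _ (g' x) = g (incl _ x)) /\ forall y, exists x, g' x = y.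
  have [|g' g'E] := @corestrict _ _ (P n) _ (g \o incl (T n))%FUN.
    by move=> x; exact: (inclP x).
  exists g'; split=> // y; have [x xE] := g_onto (incl _ y).
  have /incl_onto[z zE] : T n x by rewrite /= xE; exact: inclP.
  by exists z; apply: incl_inj; rewrite g'E /= zE xE.
(* If all maps from [T n] to [U] extended to [T n.+1], the quotient of [P n.+1] by [P n] would lie
   in [Y] by [lifts_quotient]. It also lies in [X], so it would vanish, against strictness. *)
have nonext n : exists phi : N -> U, linear_on (T n) phi /\
    ~ exists psi : {linear submod (T n.+1) -> U},
        forall x, T n (incl _ x) -> psi x = phi (incl _ x).
  apply: contrapT => nH; have [_ _ [x0 Px0]] := chainP n; apply.
  have [i iE] := incl_le (TS n n.+1 (leqnSn n)).
  have [g' [g'E g'_onto]] := gT n.+1.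
  pose K := preim_sub (incl (P n.+1)) (P n).
  have XJ : X (quot K).
    have [XP _ _] := chainP n.+1.
    exact: (torsion_quotient XY (@proj_onto _ _ K)).
  suff YJ : Y (quot K).
    have [y <-] := incl_onto Px0.
    by apply: (proj_eq0 K y).1; exact: (torsion_and_free XY _ XJ YJ).
  apply/YE; apply: (@lifts_quotient _ _ _ _ _ _ io_pi _ _ _ i (proj K \o g')%FUN).
  - split=> [x y xy|b|c].
    + by apply: incl_inj; rewrite -iE xy iE.
    + rewrite /= proj_eq0 /= g'E; split=> [Pb|[a <-]]; last first.
        by rewrite iE; exact: (inclP a).
      have [a aE] := @incl_onto _ _ (T n) _ Pb.
      by exists a; apply: incl_inj; rewrite iE aE.
    + have [y <-] := proj_onto c; have [x <-] := g'_onto y; by exists x.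
  - by apply/YE; exact: (torsion_free_sub XY (@incl_inj _ _ (T n.+1)) YN).
  move=> u; apply: contrapT => nu; apply: nH.
  have [phi phiL phiE] := linear_on_exists u; exists phi; split=> // -[psi psiE].
  apply: nu; exists psi => a; rewrite psiE iE ?phiE //; exact: inclP.
have [phi phiE] := choice nonext.
have phiL m n : (m <= n)%N -> linear_on (T m) (phi n).
  by move=> mn; apply: linear_on_sub (phiE n).1; exact: TS.
have [|Phi PhiE] := @linear_exists _ (submod (T 0%N)) (nat -> U)
    (fun x n => phi n (incl _ x)).
  by move=> a x y; apply: funext => n; rewrite linearP (phiL 0%N) //; exact: inclP.
(* [T 0] is finitely generated, so the supports of all [p (Phi x)] lie in one finite set; [k] is one
   more than its maximum. *)
have [k kE] : exists k, forall x, p (Phi x) k = 0.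
  have [l [r rE]] := fgT0.
  have [|r' r'E] := @corestrict _ _ (T 0%N) _ r; first by move=> c; apply/rE; exists c.
  pose J : set nat :=
    (\bigcup_(i in [set: 'I_l]) [set t | p (Phi (r' (delta_mx 0 i))) t <> 0])%classic.
  have /finite_seqP[s sE] : finite_set J.
    by apply: bigcup_finite => [|i _]; [exact: finite_finset | exact: ds_support].
  exists (\max_(i <- s) i).+1 => x; set k := _.+1.
  have nJk : ~ J k.
    rewrite sE => /= ks.
    by have := @leq_bigmax_seq _ s xpredT id k ks isT; rewrite ltnn.
  have /rE[c cE] := inclP x.
  have -> : x = r' c by apply: incl_inj; rewrite r'E.
  have [w wE] : exists w : {linear 'rV[S]_l -> U}, forall c, w c = p (Phi (r' c)) k.
    by exists (ds_eval k \o p \o Phi \o r')%FUN.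
  rewrite -wE row_mapE big1 // => i _; rewrite wE.
  suff -> : p (Phi (r' (delta_mx 0 i))) k = 0 by rewrite scaler0.
  by apply: contrapT => nz; apply: nJk; exists i.
have [_ []] := phiE k.
(* The tail of the family beyond [k] makes sense on all of [T k.+1]. On [T 0] the whole family is
   this tail plus a finitely supported part fixed by [p], so coordinate [k] gives that [phi k]
   equals [psi] there. *)
pose F0 (x : submod (T k.+1)) : nat -> U :=
  fun n => if (k < n)%N then phi n (incl _ x) else 0.
have [|F FE] := @linear_exists _ _ _ F0.
  move=> a x y; apply: funext => n; rewrite -[RHS]/(a *: F0 x n + F0 y n) /F0.
  case: ifP => [kn|_]; last by rewrite scaler0 addr0.
  by rewrite linearP (phiL k.+1) //; exact: inclP.
have [psi psiE] := linear_exists (f := fun x => - ds_eval k (p (F x)))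
  (fun a x y => linearP (-%R \o ds_eval k \o p \o F)%FUN a x y).
have [i iE] := incl_le (TS k k.+1 (leqnSn k)).
have [u0 u0E] := linear_on_restrict (phiL k k (leqnn k)).
have [d dE] := linear_sub_exists u0 (psi \o i)%FUN.
suff d0 x : d x = 0.
  exists psi => x /incl_onto[y yE]; have -> : x = i y by apply: incl_inj; rewrite iE.
  by apply/esym/subr0_eq; rewrite iE -u0E -[RHS](d0 y) dE.
(* [d] is the defect of [psi] on [T k]. It vanishes on [T 0], which contains the kernel of [g], so
   it factors through the torsion module [P k]. *)
have [g' [g'E g'_onto]] := gT k.
have [|h hE] := @factor_onto _ _ _ _ g' d g'_onto.
  move=> y g'y; have /incl_onto[z zE] : T 0%N (incl _ y).
    by rewrite /= -g'E g'y linear0; exact: sub0.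
  rewrite dE u0E /= psiE opprK.
  pose b n := if (n <= k)%N then phi n (incl _ z) else 0.
  have bfs : b \in @Defs.finite_support S nat U.
    apply/asboolP; apply: sub_finite_set (finite_II k.+1) => n /=.
    by rewrite /b ltnS; case: ifP.
  have PhibF : Phi z = ds_val nat U (DirectSum bfs) + F (i y).
    apply: funext => n; rewrite -[RHS]/(b n + F (i y) n) PhiE FE /F0 /b iE zE ltnNge.
    by case: ifP => _; rewrite ?addr0 ?add0r.
  have := kE z; rewrite PhibF linearD pK.
  rewrite -[X in X -> _]/(b k + ds_eval k (p (F (i y))) = 0).
  by rewrite /b leqnn zE.
rewrite -hE; have [XPk _ _] := chainP k.
exact: (torsion_hom0 XY _ _ XPk YU).
Qed.

Lemma Sigma_pure_injective_Reiten_Ringel :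
  noetherian_module S^o -> Sigma_pure_injective U -> Reiten_Ringel X Y.
Proof.
move=> noethS SU N0 N Q f g [fI ex g_onto] YN fgN0 _ XQ.
have [p pK] := direct_sum_retract (SU nat).
have fg_preim_g (P : submodule Q) : fg_sub P -> fg_sub (preim_sub g P).
  exact: (fg_preim (f := f)).
have fgtau : fg_sub (tau XY Q).
  apply: contrapT => /tau_chain[P PE].
  apply: (@retract_chain_false _ _ g P p pK YN g_onto).
    by apply: fg_preim_g; have [[]] := PE 0%N.
  by move=> n; have [[_ XP] PS Px] := PE n.
(* The quotient by [tau] is in [Y] by local torsion-freeness and in [X] as a quotient of [Q], so it
   is zero. *)
have Yq : Y (quot (tau XY Q)).
  apply: pure_injective_locally; first exact: Sigma_pure_injectiveW.
  exact: tau_locally.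
have Xq : X (quot (tau XY Q)) by exact: (torsion_quotient XY (@proj_onto _ _ _)).
have : fg_sub (full_sub N).
  apply: fg_ext (fg_preim_g _ fgtau) => x; split=> // _.
  by apply: (proj_eq0 (tau XY Q) (g x)).1; exact: (torsion_and_free XY _ Xq Yq).
move=> [n [r rE]]; apply/finitely_generatedP; exists n, r => x.
exact: (rE x).1.
Qed.

End PureInjective.

(* The tree whose nodes at level n.+1 record a node a at level n together with a
   function on the whole of level n: a branch is then a family of functions on all
   the levels, so there are as many branches as H-valued functions on the nodes. *)
Section Tree.
Variable H : Type.

Fixpoint level (n : nat) : Type :=
  if n is n'.+1 then (level n' * (level n' -> H))%type else unit.
Definition node : Type := {n & level n}.
Definition branch : Type := forall n, level n -> H.

Fixpoint prefix (b : branch) (n : nat) : level n :=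
  if n is n'.+1 then (prefix b n', b n') else tt.
Definition prefix_node (b : branch) (n : nat) : node := existT level n (prefix b n).

(** A prefix of length [n.+1] stores [b n], so a difference at level [N] shows from level [N.+1]
    on. *)
Lemma prefix_split (b b' : branch) : b <> b' ->
  exists N, forall n, (N <= n)%N -> prefix b n <> prefix b' n.
Proof.
move=> bb'; have [N bN] : exists N, b N <> b' N.
  apply: contrapT => H0; apply: bb'; apply: functional_extensionality_dep => n.
  by apply: contrapT => bn; apply: H0; exists n.
by exists N.+1 => n /subnK<-; elim: (n - N.+1)%N => [|d IHd] /= [] // *.
Qed.

End Tree.

(** * Closure of the torsion-free class under countable unions *)

Section Unions.
Variables (S : pzRingType) (X Y : lmodType S -> Prop).
Variables (E0 E1 : lmodType S) (pi : {linear E0 -> E1}).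
Hypothesis XY : torsion_pair X Y.
Hypothesis YE : forall M, Y M <-> lifts pi M.

Variables (M : lmodType S) (D : nat -> submodule M).
Hypothesis D_exhaustive : forall x, exists N, forall n, (N <= n)%N -> D n x.
Hypothesis YD : forall n, Y (submod (D n)).

(** Taking the eventual value presents [M] as the quotient of this module by the finitely supported
    sequences, the direct sum of the [D n]. *)
Definition eventually_const_sub : submodule (nat -> M).
Proof.
exists (fun s => (forall n, D n (s n)) /\ exists m N, forall n, (N <= n)%N -> s n = m).
split; first by split=> [n|]; [exact: sub0 | exists 0, 0%N].
move=> a s t [Ds [m [N sN]]] [Dt [m' [N' tN]]]; split=> [n|]; first exact: subL.
exists (a *: m + m'), (maxn N N') => n; rewrite geq_max => /andP[/sN sn /tN tn].
by rewrite -[LHS]/(a *: s n + t n) sn tn.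
Defined.

Local Notation C := eventually_const_sub.

Lemma limit_exists : exists lim : {linear submod C -> M},
  forall s, exists N, forall n, (N <= n)%N -> incl C s n = lim s.
Proof.
have /choice[l lE] (s : submod C) :
    exists m, exists N, forall n, (N <= n)%N -> incl C s n = m.
  by have [] := inclP s.
have [|lim limE] := linear_exists (f := l); last by exists lim => s; rewrite limE.
move=> a s t; have [[N sN] [N' tN] [N'' stN]] := And3 (lE s) (lE t) (lE (a *: s + t)).
pose n := maxn N (maxn N' N'').
rewrite -(stN n) ?leq_max ?leqnn ?orbT // linearP -(sN n) ?leq_max ?leqnn ?orbT //.
by rewrite -(tN n) ?leq_max ?leqnn ?orbT.
Qed.

(** The labels of the tree record values of a would-be lift on the copies of the [D n]; total
    functions on [M] keep the label type independent of [n]. *)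
Let H := M -> E0.

(** These families stabilise along every branch, with only finitely many nonzero limits. Sitting
    inside a product of the [D n], they form a module in [Y]. *)
Definition tree_sub : submodule (node H -> M).
Proof.
exists (fun x => (forall t, D (tag t) (x t)) /\
  exists y : direct_sum (branch H) M, forall b, exists N, forall n, (N <= n)%N ->
    x (prefix_node b n) = y b).
split; first by split=> [n|]; [exact: sub0 | exists 0 => b; exists 0%N].
move=> a s t [Ds [y sy]] [Dt [z tz]]; split=> [n|]; first exact: subL.
exists (a *: y + z) => b; have [[N sN] [N' tN]] := conj (sy b) (tz b).
exists (maxn N N') => n; rewrite geq_max => /andP[/sN sn /tN tn].
by rewrite -[LHS]/(a *: s _ + t _) sn tn.
Defined.

Lemma branch_limit_exists :
  exists lam : {linear submod tree_sub -> direct_sum (branch H) M},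
  forall x (y : direct_sum (branch H) M), (forall b, exists N, forall n, (N <= n)%N ->
    incl tree_sub x (prefix_node b n) = y b) -> lam x = y.
Proof.
have uniq_lim (x : node H -> M) (y z : direct_sum (branch H) M) :
    (forall b, exists N, forall n, (N <= n)%N -> x (prefix_node b n) = y b) ->
    (forall b, exists N, forall n, (N <= n)%N -> x (prefix_node b n) = z b) -> y = z.
  move=> xy xz; apply: val_inj; apply: funext => b /=.
  have [[N yN] [N' zN]] := conj (xy b) (xz b).
  by rewrite -(yN (maxn N N')) ?leq_maxl // (zN (maxn N N')) ?leq_maxr.
have /choice[l lE] (x : submod tree_sub) : exists y : direct_sum (branch H) M,
    forall b, exists N, forall n, (N <= n)%N -> incl tree_sub x (prefix_node b n) = y b.
  by have [] := inclP x.
have [|lam lamE] := linear_exists (f := l).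
  move=> a x y; apply: uniq_lim (lE _) _ => b.
  have [[N xN] [N' yN]] := conj (lE x b) (lE y b).
  exists (maxn N N') => n; rewrite geq_max => /andP[/xN xn /yN yn].
  by rewrite linearP -[LHS]/(a *: incl _ x _ + incl _ y _) xn yn.
by exists lam => x y xy; rewrite lamE; exact: uniq_lim (lE x) xy.
Qed.

Lemma torsion_free_tree : Y (submod tree_sub).
Proof.
have f_ex (t : node H) : exists f : {linear submod tree_sub -> submod (D (tag t))},
    forall x, incl _ (f x) = incl _ x t.
  have [ev evE] := @linear_exists _ (node H -> M) M (fun x => x t) (fun _ _ _ => erefl).
  have [|f fE] := @corestrict _ _ (D (tag t)) _ (ev \o incl tree_sub)%FUN.
    by move=> x; rewrite /= evE; have [+ _] := inclP x; apply.
  by exists f => x; rewrite fE /= evE.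
pose f t := projT1 (cid (f_ex t)).
have fE t x : incl _ (f t x) = incl _ x t by exact: projT2 (cid (f_ex t)) x.
apply: (@torsion_free_product S X Y XY _ _ _ f) => // x fx; apply: incl_inj.
by rewrite linear0; apply: funext => t; rewrite -fE fx linear0.
Qed.

Definition on_branch (b : branch H) (s : nat -> M) (t : node H) : M :=
  if `[< projT2 t = prefix b (projT1 t) >] then s (projT1 t) else 0.

Lemma on_branch_single b n m : on_branch b (single n m) = single (prefix_node b n) m.
Proof.
apply: funext => -[k a]; rewrite /on_branch /=; case: asboolP => [->|ak]; last first.
  rewrite single_ne // => kn; apply: ak.
  have : projT2 (prefix_node b n) = prefix b (projT1 (prefix_node b n)) by [].
  by rewrite -kn.
have [->|/eqP kn] := eqVneq k n; first by rewrite !singleE.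
by rewrite !single_ne // => /(congr1 (@projT1 _ _)).
Qed.

(** Distinct branches share only an initial segment, so a sequence placed on [b] has limit zero
    along every other branch. *)
Lemma on_branch_exists (b : branch H) : exists J : {linear submod C -> submod tree_sub},
  forall s, incl tree_sub (J s) = on_branch b (incl C s).
Proof.
have [|J0 J0E] := @linear_exists _ _ _ (on_branch b).
  move=> a s t; apply: funext => -[n c].
  rewrite -[RHS]/(a *: on_branch b s _ + on_branch b t _) /on_branch.
  by case: ifP => // _; rewrite scaler0 addr0.
have [|J JE] := @corestrict _ _ tree_sub _ (J0 \o incl C)%FUN; last first.
  by exists J => s; rewrite JE /= J0E.
move=> s /=; rewrite J0E; have [Ds [m [N sN]]] := inclP s; split=> [[n c]|].
  by rewrite /on_branch; case: ifP => _; [exact: Ds | exact: sub0].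
exists (ds_single b m) => b'; have [->|bb'] := pselect (b' = b).
  exists N => n Nn; rewrite /on_branch /= asboolT // sN //.
  by rewrite singleE.
have [N' bN'] := prefix_split bb'; exists N' => n N'n.
by rewrite /on_branch /= asboolF ?single_ne //; exact: bN'.
Qed.

(* Bazzoni's counting argument, as a diagonal one: on branch b the obstruction xi is
   switched on exactly when no lift of it restricts to b; the branch read off
   from a global lift eta then refutes the choice made there. *)
Lemma torsion_free_union : Y M.
Proof.
apply/YE => xi; have [lim limE] := limit_exists.
have limP (s : submod C) m N : (forall n, (N <= n)%N -> incl C s n = m) -> lim s = m.
  move=> sm; have [N' sN'] := limE s.
  by rewrite -(sN' (maxn N N')) ?leq_maxr // sm ?leq_maxl.
have [lam lamE] := branch_limit_exists.
(* A lift of [xi] along [lim] whose restriction to the direct sum of the [D n] is the one recorded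
   in [b] along its own prefixes. *)
pose good (b : branch H) := exists theta : {linear submod C -> E0},
  (forall s, pi (theta s) = xi (lim s)) /\
  forall n m s, D n m -> incl C s = single n m -> theta s = b n (prefix b n) m.
pose xi_on b : {linear M -> E1} :=
  if `[< ~ good b >] then xi else \0.
have [Xi XiE] := ds_sum_exists xi_on.
have [eta etaE] := (YE _).1 torsion_free_tree (Xi \o lam)%FUN.
have [phi _ phiE] := linear_on_exists eta.
(* Each node is labelled by the values of [eta] on families concentrated there. *)
pose b : branch H := fun n c m => phi (single (existT _ n c) m).
have [J JE] := on_branch_exists b.
have lamJ s : lam (J s) = ds_single b (lim s).
  apply: lamE => b'; have [->|bb'] := pselect (b' = b).
    have [N sN] := limE s; exists N => n Nn.
    by rewrite JE /on_branch /= asboolT // sN // singleE.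
  have [N bN] := prefix_split bb'; exists N => n Nn.
  by rewrite JE /on_branch /= asboolF ?single_ne //; exact: bN.
have etaJ n m s : D n m -> incl C s = single n m -> eta (J s) = b n (prefix b n) m.
  by move=> Dm sE; rewrite -phiE JE sE on_branch_single.
have piJ s : pi (eta (J s)) = xi_on b (lim s).
  by rewrite etaE /= lamJ XiE.
(* Were [b] not good, [xi] would be switched on along it, and the restriction of [eta] to [b] would
   be a witness of goodness. *)
have : good b.
  apply: contrapT => nb; apply: (nb); exists (eta \o J)%FUN.
  split=> [s|]; last exact: etaJ.
  by rewrite /= piJ /xi_on asboolT.
move=> gb; have [theta [pitheta thetaE]] := gb.
(* Since [b] is good, [xi] is switched off along it and the restriction of [eta] lifts zero. Hence
   [zeta] still lifts [xi]; it also kills the direct sum of the [D n], so it descends to [M]. *)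
have [zeta zetaE] := linear_sub_exists theta (eta \o J)%FUN.
have zeta_single n m s : D n m -> incl C s = single n m -> zeta s = 0.
  by move=> Dm sE; rewrite zetaE /= (thetaE n m) // (etaJ n m) // subrr.
have zeta0 N s : (forall n, (N <= n)%N -> incl C s n = 0) -> zeta s = 0.
  elim: N s => [|N IHN] s s0.
    have -> : s = 0 by apply: incl_inj; rewrite linear0; apply: funext => n; exact: s0.
    exact: linear0.
  have DN : D N (incl C s N) by have [+ _] := inclP s; apply.
  have [|s' s'E] := @incl_onto _ _ C (single N (incl C s N)).
    split=> [n|]; last first.
      by exists 0, N.+1 => n Nn; rewrite single_ne // => nN; rewrite nN ltnn in Nn.
    by rewrite /single; case: asboolP => [->//|_]; exact: sub0.
  rewrite -(subrK s' s) linearD (zeta_single N (incl C s N) s') // addr0.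
  apply: IHN => n Nn; rewrite linearB -[LHS]/(incl C s n - incl C s' n) s'E.
  have [->|/eqP nN] := eqVneq n N; first by rewrite singleE subrr.
  by rewrite single_ne // s0 ?subr0 // ltn_neqAle Nn andbT; apply/eqP => /esym.
have lim_onto m : exists s, lim s = m.
  have [N Dm] := D_exhaustive m.
  have [|s sE] := @incl_onto _ _ C (fun n => if (N <= n)%N then m else 0).
    split=> [n|]; last by exists m, N => n ->.
    by case: ifP => [/Dm//|_]; exact: sub0.
  by exists s; apply: (limP s m N) => n Nn; rewrite sE Nn.
have [|h hE] := @factor_onto _ _ _ _ lim zeta lim_onto.
  by move=> s s0; have [N sN] := limE s; apply: (zeta0 N) => n /sN->.
exists h => m; have [s <-] := lim_onto m.
by rewrite hE zetaE linearB /= pitheta piJ /xi_on asboolF ?subr0 //; exact.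
Qed.

End Unions.

(** * The Reiten-Ringel condition and locally torsion-free modules *)

Section ReitenRingel.
Variable S : pzRingType.

Lemma quot_embed (B C : lmodType S) (D : submodule B) (k : {linear B -> C}) :
  (forall x, k x = 0 <-> D x) ->
  exists2 h : {linear quot D -> C}, injective h & forall x, h (proj D x) = k x.
Proof.
move=> kD; have [|h hE] := @factor_onto _ _ _ _ (proj D) k (@proj_onto _ _ D).
  by move=> x /proj_eq0/kD.
exists h => //; apply: linear_inj0 => y; have [x <-] := proj_onto y.
by rewrite hE => /kD Dx; apply/proj_eq0.
Qed.

Lemma fg_finitely_presented (F : lmodType S) :
  noetherian_module S^o -> finitely_generated F -> finitely_presented F.
Proof.
move=> noethS /finitely_generatedP[n [p p_onto]].
have [m [r rE]] := noetherian_row noethS (ker_sub p).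
by exists m, n, r, p; split.
Qed.

Definition directed_union (M : lmodType S) (DD : submodule M -> Prop)
  (dirD : directed DD) : submodule M.
Proof.
exists (fun x => exists2 D : submodule M, DD D & D x); split.
  by have [[D DDD] _] := dirD; exists D => //; exact: sub0.
move=> a x y [D DDD Dx] [E DDE Ey].
have [D' [DD' DD'1 ED']] := dirD.2 _ _ DDD DDE.
by exists D' => //; apply: subL; [exact: DD'1 | exact: ED'].
Defined.

Lemma chain_directed (M : lmodType S) (P : nat -> submodule M) :
  (forall n x, P n x -> P n.+1 x) ->
  directed (fun D => exists n, D = P n) /\
  forall m n, (m <= n)%N -> forall x, P m x -> P n x.
Proof.
move=> PS; have mono m n : (m <= n)%N -> forall x, P m x -> P n x.
  by move=> /subnK<-; elim: (n - m)%N => // d IHd x /IHd/PS.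
split=> //; split; first by exists (P 0%N), 0%N.
move=> _ _ [m ->] [n ->]; exists (P (maxn m n)).
by split; [exists (maxn m n) | exact/mono/leq_maxl | exact/mono/leq_maxr].
Qed.

Variables (X Y : lmodType S -> Prop).
Hypothesis XY : torsion_pair X Y.
Hypothesis noethS : noetherian_module S^o.

(** The relations of a finitely generated submodule of the quotient by [D] are finitely generated,
    so they already hold modulo a single [D'] of the family. *)
Lemma locally_directed_union (B : lmodType S) (DD : submodule B -> Prop)
    (D : submodule B) :
  directed DD -> (forall x, D x <-> exists2 D' : submodule B, DD D' & D' x) ->
  (forall D', DD D' -> locally_torsion_free Y (quot D')) ->
  locally_torsion_free Y (quot D).
Proof.
move=> dirD DE locD N f fgN fI; have /finitely_generatedP[n [r r_onto]] := fgN.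
have [|s sE] := @row_lift _ _ _ _ (proj D) (f \o r)%FUN.
  by move=> c; exact: proj_onto.
have sD c : D (s c) <-> r c = 0.
  rewrite -proj_eq0 sE /=; split=> [/(inj_eq0 fI)//|->]; exact: linear0.
have [||D' DD' LD'] := @fg_directed _ _ _ (image_sub s (ker_sub r)) dirD.
- exact/fg_image/noetherian_row.
- by move=> _ [c /= rc <-]; apply/DE/sD.
have D'D c : D' (s c) <-> r c = 0.
  split=> [D's|rc]; last by apply: LD'; exists c.
  by apply/sD/DE; exists D'.
have [|h hE] := @factor_onto _ _ _ _ r (proj D' \o s)%FUN r_onto.
  by move=> c /D'D/proj_eq0.
apply: (locD D' DD' N h) => //; apply: linear_inj0 => y.
by have [c <-] := r_onto y; rewrite hE /= => /proj_eq0/D'D.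
Qed.

Lemma torsion_directed_union (M : lmodType S) (DD : submodule M -> Prop)
    (dirD : directed DD) :
  (forall D, DD D -> X (submod D)) -> X (submod (directed_union dirD)).
Proof.
move=> XD; apply: (torsion_sum XY) => x; have [D DDD Dx] := inclP x.
have [|i iE] := @incl_le _ _ D (directed_union dirD).
  by move=> y Dy; exists D.
have [y yE] := incl_onto Dx; exists (submod D), (submod D), i, i, y, 0.
split; [exact: XD | exact: XD |].
by apply: incl_inj; rewrite linear0 addr0 iE.
Qed.

Variables (E0 E1 : lmodType S) (pi : {linear E0 -> E1}).
Hypothesis YE : forall M, Y M <-> lifts pi M.
Hypothesis RR : Reiten_Ringel X Y.

(** Otherwise a strict chain of finitely generated torsion submodules has a union whose preimage
    [Tw] in [C] is a countable union of modules in [Y]. By [torsion_free_union] it lies in [Y], so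
    the Reiten-Ringel condition makes it finitely generated and the chain stops. *)
Lemma tau_quotient_cyclic_fg (C : lmodType S) (x0 : C) :
  locally_torsion_free Y C -> x0 <> 0 -> fg_sub (tau XY (quot (cyclic x0))).
Proof.
move=> locC x0N; set q := proj (cyclic x0); apply: contrapT => /tau_chain[P PE].
have PS n x : P n x -> P n.+1 x by have [_ + _] := PE n; apply.
have [dirP Pmono] := chain_directed PS.
pose Pw := directed_union dirP; pose Tw := preim_sub q Pw.
pose D n : submodule (submod Tw) := preim_sub (incl Tw) (preim_sub q (P n)).
have DS n x : D n x -> D n.+1 x by exact: PS.
have [dirD Dmono] := chain_directed DS.
have x0_cyclic x : q x = 0 <-> cyclic x0 x by exact: proj_eq0.
have fgT n : fg_sub (preim_sub q (P n)).
  apply: (fg_preim (short_exact_quot (cyclic x0))); first exact/fg_subP/fg_cyclic.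
  by have [[]] := PE n.
have Yw : Y (submod Tw).
  apply: (torsion_free_union XY YE (D := D)) => [x|n].
    have [_ [N ->] PN] := inclP x; exists N => n Nn.
    exact: (Dmono N).
  have [|j jE] := @corestrict _ _ (preim_sub q (P n)) _ (incl Tw \o incl (D n))%FUN.
    by move=> x; exact: (inclP x).
  apply: (torsion_free_sub XY (f := j)).
    move=> x y xy; apply/(@incl_inj _ _ (D n))/(@incl_inj _ _ Tw).
    by rewrite -[LHS]jE xy jE.
  by apply: (locC _ (incl _)); [exact/fg_subP | exact: incl_inj].
have [|i iE] := @incl_le _ _ (cyclic x0) Tw.
  by move=> x /x0_cyclic qx; rewrite /= qx; exact: (sub0 Pw).
have [|g gE] := @corestrict _ _ Pw _ (q \o incl Tw)%FUN.
  by move=> x; exact: (inclP x).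
have fgTw : finitely_generated (submod Tw).
  apply: (RR (f := i) (g := g)) => //.
  - split=> [x y xy|b|c].
    + by apply: incl_inj; rewrite -iE xy iE.
    + split=> [gb|[a <-]]; last first.
        apply: incl_inj; rewrite gE linear0 /= iE; exact/x0_cyclic/inclP.
      have /x0_cyclic/incl_onto[a aE] : q (incl Tw b) = 0.
        by rewrite -[LHS]gE gb linear0.
      by exists a; apply: incl_inj; rewrite iE.
    + have [x xE] := proj_onto (incl _ c).
      have /incl_onto[b bE] : Tw x by rewrite /= /q xE; exact: (inclP c).
      by exists b; apply: incl_inj; rewrite gE /= bE.
  - exact/fg_subP/fg_cyclic.
  - have [y yE] := incl_onto (cyclicP x0).
    by exists y => y0; apply: x0N; rewrite -yE y0 linear0.
  - by apply: torsion_directed_union => _ [n ->]; have [[]] := PE n.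
have [|_ [n ->] allD] := @fg_directed _ _ _ (full_sub (submod Tw)) dirD (fg_full fgTw).
  by move=> x _; have [_ [n ->] Px] := inclP x; exists (D n) => //; exists n.
have [_ _ [y Py]] := PE n; apply; have [x xE] := proj_onto y.
have /incl_onto[z zE] : Tw x by exists (P n.+1); [exists n.+1 | rewrite /= /q xE].
by have := allD z I; rewrite /= zE /q xE.
Qed.

(** For [T] the preimage of [tau], the quotient of [C] by [T] embeds in a quotient by [tau], so
    [tau_locally] applies. *)
Lemma Reiten_Ringel_step (C : lmodType S) (x0 : C) :
  locally_torsion_free Y C -> x0 <> 0 ->
  exists T : submodule C,
    [/\ fg_sub T, T x0 & locally_torsion_free Y (quot T)].
Proof.
move=> locC x0N; have fgtau := tau_quotient_cyclic_fg locC x0N.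
set q := proj (cyclic x0); exists (preim_sub q (tau XY _)); split.
- apply: (fg_preim (short_exact_quot (cyclic x0))) => //; exact/fg_subP/fg_cyclic.
- have qx0 : q x0 = 0 by exact/proj_eq0/cyclicP.
  by change (tau XY _ (q x0)); rewrite qx0; exact: sub0.
have [|h hI _] := @quot_embed _ _ (preim_sub q (tau XY _)) (proj (tau XY _) \o q)%FUN.
  by move=> x; exact: proj_eq0.
exact: (locally_torsion_free_sub hI (tau_locally noethS)).
Qed.

End ReitenRingel.

(** * Sigma-pure-injectivity from the Reiten-Ringel condition *)

Section ReitenRingelSigma.
Variables (S : pzRingType) (X Y : lmodType S -> Prop).
Hypothesis XY : torsion_pair X Y.
Hypothesis noethS : noetherian_module S^o.
Variables (U E0 E1 : lmodType S) (io : {linear U -> E0}) (pi : {linear E0 -> E1}).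
Hypothesis io_pi : short_exact io pi.
Hypothesis injE0 : injective_module E0.
Hypothesis YE : forall M, Y M <-> lifts pi M.
Hypothesis YU : Y U.

(** The kernel [K] of a finite free cover of [F] is finitely generated, so a map from it to [U^(I)]
    meets finitely many coordinates and can be extended one coordinate at a time. *)
Lemma fg_ext1_zero_direct_sum (I : Type) (F : lmodType S) :
  finitely_generated F -> Y F -> ext1_zero F (direct_sum I U).
Proof.
move=> /finitely_generatedP[n [p p_onto]] YF A B i g u [iI ex g_onto].
have gi a : g (i a) = 0 by apply/ex; exists a.
have [|r rE] := @row_lift _ _ _ _ g p; first by move=> c; exact: g_onto.
pose K := ker_sub p.
have [|k kE] := @lift_inj _ _ _ _ i (r \o incl K)%FUN iI.
  by move=> x; apply/ex; rewrite rE; exact: (inclP x).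
pose v := (u \o k)%FUN.
have [m [t tE]] : fg_sub (full_sub (submod K)).
  exact/fg_full/fg_subP/noetherian_row.
pose J : set I :=
  (\bigcup_(j in [set: 'I_m]) [set l | v (t (delta_mx 0 j)) l <> 0])%classic.
have finJ : finite_set J.
  by apply: bigcup_finite => [|j _]; [exact: finite_finset | exact: ds_support].
have vJ x l : ~ J l -> v x l = 0.
  move=> nJl; have [c <-] := (tE x).1 Logic.I.
  have [w wE] : exists w : {linear 'rV[S]_m -> U}, forall c, w c = v (t c) l.
    by exists (ds_eval l \o v \o t)%FUN.
  rewrite -wE row_mapE big1 // => j _; rewrite wE.
  suff -> : v (t (delta_mx 0 j)) l = 0 by rewrite scaler0.
  by apply: contrapT => vl; apply: nJl; exists j.
have exK : short_exact (incl K) p.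
  split=> [|b|//]; first exact: incl_inj.
  by split=> [pb|[a <-]]; [exact: (@incl_onto _ _ K b pb) | exact: (inclP a)].
(* The zero extension is imposed outside [J], so that the assembled map has finite support. *)
have /choice[e eE] (l : I) : exists e : {linear 'rV[S]_n -> U},
    (forall x, e (incl K x) = v x l) /\ (~ J l -> forall c, e c = 0).
  have [Jl|nJl] := pselect (J l).
    have extF := lifts_ext1_zero io_pi injE0 ((YE F).1 YF).
    have [e eE] := extF _ _ _ _ (ds_eval l \o v)%FUN exK.
    by exists e.
  by exists \0; split=> // x; rewrite vJ.
have [|e0 e0E] := @linear_exists _ 'rV[S]_n (I -> U) (fun c l => e l c).
  by move=> a x y; apply: funext => l; rewrite linearP.
have [|e' e'E] := @lift_inj _ _ _ _ (ds_val I U) e0 (fun x y => @val_inj _ _ _ x y).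
  move=> c; have fs : e0 c \in @Defs.finite_support S I U.
    apply/asboolP; apply: sub_finite_set finJ => l /= el.
    by apply: contrapT => nJl; apply: el; rewrite e0E (eE l).2.
  by exists (DirectSum fs).
have e'K x : e' (incl K x) = v x.
  apply: val_inj; apply: funext => l.
  by rewrite -[LHS]/(ds_val I U (e' (incl K x)) l) e'E e0E (eE l).1.
(* [B] is the pushout of [A] and the free module along [K]; [u] and [e'] agree on [K] and therefore
   glue. *)
have [|q qE] := @linear_exists _ (A * 'rV[S]_n)%type B (fun z => i z.1 + r z.2).
  by move=> a x y; rewrite !linearP scalerDr addrACA.
have [|w wE] := @linear_exists _ (A * 'rV[S]_n)%type (direct_sum I U)
    (fun z => u z.1 + e' z.2).
  by move=> a x y; rewrite !linearP scalerDr addrACA.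
have [||h hE] := @factor_onto _ _ _ _ q w.
- move=> b; have [c cE] := p_onto (g b).
  have [a aE] : exists a, i a = b - r c by apply/ex; rewrite linearB /= rE cE subrr.
  by exists (a, c); rewrite qE /= aE subrK.
- move=> [a c]; rewrite qE wE /= => irc.
  have /(@incl_onto _ _ K)[x xE] : p c = 0.
    by rewrite -rE -[LHS]add0r -(gi a) -linearD irc linear0.
  have -> : a = - k x.
    by apply: iI; rewrite linearN /= kE /= xE; apply/eqP; rewrite -addr_eq0 irc.
  by rewrite -xE e'K linearN addNr.
exists h => a; have -> : i a = q (a, 0) by rewrite qE /= linear0 addr0.
by rewrite hE wE /= linear0 addr0.
Qed.

(* Eklof's argument: extend along a filtration of B / A with finitely generated
   torsion-free factors, by Zorn's lemma on the graphs of partial extensions. *)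
Lemma locally_torsion_free_ext1_zero (W C : lmodType S) :
  Reiten_Ringel X Y ->
  (forall F, finitely_generated F -> Y F -> ext1_zero F W) ->
  locally_torsion_free Y C -> ext1_zero C W.
Proof.
move=> RR extW locC A B i g u [iI ex g_onto].
have [fstL fstE] := @linear_exists _ (B * W)%type B fst (fun _ _ _ => erefl).
pose dom (G : submodule (B * W)%type) := image_sub fstL G.
have domP G b : dom G b <-> exists w, G (b, w).
  split=> [[[b' w] Gw <-]|[w Gw]]; first by exists w; rewrite fstE.
  by exists (b, w); rewrite ?fstE.
(* The last clause is the invariant of the transfinite extension: the part of [B] not yet covered
   stays locally torsion-free. *)
pose good (G : submodule (B * W)%type) :=
  [/\ forall a, G (i a, u a), forall w, G (0, w) -> w = 0
    & locally_torsion_free Y (quot (dom G))].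
have [|iu iuE] := @linear_exists _ A (B * W)%type (fun a => (i a, u a)).
  by move=> a x y; rewrite !linearP.
pose G0 := range_sub iu.
have good0 : good G0.
  split=> [a|w [a]|]; first by exists a.
    by rewrite iuE => -[/(inj_eq0 iI) -> <-]; exact: linear0.
  have [|h hI _] := @quot_embed _ _ _ (dom G0) g; last first.
    exact: (locally_torsion_free_sub hI locC).
  move=> b; rewrite domP ex; split=> [[a <-]|[w [a]]]; last first.
    by rewrite iuE => -[<-]; exists a.
  by exists (u a), a.
(* Zorn's lemma also asks about the empty chain, whose union is empty; adding [G0] separately makes
   the empty set admissible. *)
pose Q (Z : set (B * W)) := exists2 G, good G & forall z, G z <-> Z z \/ G0 z.
have [F FQ Ftot|Z [[G goodG GE] Zmax]] := @Zorn_bigcup (B * W)%type Q.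
  pose DD G := good G /\ (G = G0 \/ exists2 Z, F Z & forall z, G z <-> Z z \/ G0 z).
  have dirDD : directed DD.
    split; first by exists G0; split=> //; left.
    move=> G1 G2 [good1 [->|[Z1 FZ1 GZ1]]] D2.
      exists G2; split=> // x; have [[G02 _ _] _] := D2; case=> a <-.
      by rewrite iuE; exact: G02.
    have [good2 [->|[Z2 FZ2 GZ2]]] := D2.
      exists G1; split=> // [|x [a <-]]; first by split=> //; right; exists Z1.
      by rewrite iuE; have [+ _ _] := good1; apply.
    have [Z12|Z21] := Ftot _ _ FZ1 FZ2.
      exists G2; split=> // x /GZ1[/Z12 Z2x|G0x]; apply/GZ2; by [left|right].
    exists G1; split=> // [|x /GZ2 Z2x]; first by split=> //; right; exists Z1.
    by apply/GZ1; case: Z2x => [/Z21|]; [left | right].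
  exists (directed_union dirDD); last first.
    move=> z; split=> [[G [_ [->|[Z FZ GZ]]]]|].
    - by right.
    - by move=> /GZ[Zz|]; [left; exists Z | right].
    - case=> [[Z FZ Zz]|G0z]; last by exists G0 => //; split=> //; left.
      have [G goodG GZ] := FQ _ FZ.
      by exists G; [split=> //; right; exists Z | apply/GZ; left].
  split=> [a|w [G [[_ G0w _] _]]|]; first by exists G0; [split=> //; left | exists a].
    exact: G0w.
  apply: (@locally_directed_union _ _ noethS _ (fun D => exists2 G, DD G & D = dom G)).
  - split; first by exists (dom G0), G0 => //; split=> //; left.
    move=> _ _ [G1 D1 ->] [G2 D2 ->]; have [G3 [D3 G13 G23]] := dirDD.2 _ _ D1 D2.
    exists (dom G3); split; first by exists G3.
      by move=> x /domP[w /G13 Gw]; apply/domP; exists w.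
    by move=> x /domP[w /G23 Gw]; apply/domP; exists w.
  - move=> x; split=> [/domP[w [G DG Gw]]|[_ [G DG ->] /domP[w Gw]]].
      by exists (dom G); [exists G | apply/domP; exists w].
    by apply/domP; exists w, G.
  - by move=> _ [G [[_ _ locG] _] ->].
have [Giu G_fun locG] := goodG.
have [G_tot|] := pselect (forall b, exists w, G (b, w)).
  have [h hE] := linear_of_graph G_tot G_fun; exists h => a.
  apply/subr0_eq/G_fun; rewrite -(subrr (i a)).
  exact: (subB (hE (i a)) (Giu a)).
move=> /existsNP[b0 nGb0]; exfalso.
have b0N : proj (dom G) b0 <> 0 by move=> /proj_eq0/domP.
(* The finitely generated layer [T] contains the class of [b0] and lies in [Y], so the partial
   extension continues over its preimage, against maximality. *)
have [T [fgT Tb0 locT]] := Reiten_Ringel_step XY noethS YE RR locG b0N.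
pose T' := preim_sub (proj (dom G)) T.
have [|pr prE] := @corestrict _ _ T _ (proj (dom G) \o incl T')%FUN.
  by move=> x; exact: (inclP x).
have [|j jE] := @incl_le _ _ (dom G) T'.
  by move=> x /proj_eq0 x0; change (T (proj (dom G) x)); rewrite x0; exact: sub0.
have [uG uGE] : exists uG : {linear submod (dom G) -> W}, forall a, G (incl _ a, uG a).
  have [|d dE] := @linear_exists _ (submod (dom G) * W)%type (B * W)%type
      (fun z => (incl _ z.1, z.2)).
    by move=> a x y; rewrite linearP.
  have [x|w|uG uGE] := @linear_of_graph _ _ _ (preim_sub d G).
  - by have /domP[w Gw] := inclP x; exists w; rewrite /= dE.
  - by rewrite /= dE /= linear0; exact: G_fun.
  by exists uG => a; have := uGE a; rewrite /= dE.
have [|||h hE] := extW (submod T) _ _ _ _ j pr uG.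
- exact/fg_subP.
- by apply: (locG _ (incl T)); [exact/fg_subP | exact: incl_inj].
- split=> [x y xy|x|y].
  + by apply: incl_inj; rewrite -jE xy jE.
  + split=> [px|[a <-]]; last first.
      by apply: incl_inj; rewrite prE linear0 /= jE; exact/proj_eq0/inclP.
    have /proj_eq0/incl_onto[a aE] : proj (dom G) (incl T' x) = 0.
      by rewrite -[LHS]prE px linear0.
    by exists a; apply: incl_inj; rewrite jE.
  + have [b bE] := proj_onto (incl _ y).
    have /incl_onto[x xE] : T' b by rewrite /= bE; exact: inclP.
    by exists x; apply: incl_inj; rewrite prE /= xE.
have [|k kE] := @linear_exists _ (submod T') (B * W)%type (fun x => (incl _ x, h x)).
  by move=> a x y; rewrite !linearP.
pose G' := range_sub k.
have GG' z : G z -> G' z.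
  case: z => b w Gw; have /incl_onto[a aE] : dom G b by apply/domP; exists w.
  exists (j a); rewrite kE jE hE aE; congr pair.
  have Gb : G (b, uG a) by rewrite -aE.
  apply/subr0_eq/G_fun; rewrite -(subrr b).
  exact: (subB Gb Gw).
have domG' b : dom G' b <-> T' b.
  rewrite domP; split=> [[w [x]]|/incl_onto[x <-]].
    by rewrite kE => -[<- _]; exact: inclP.
  by exists (h x), x; rewrite kE.
have goodG' : good G'.
  split=> [a|w [x]|]; first exact/GG'/Giu.
    by rewrite kE => -[/(inj_eq0 (@incl_inj _ _ _)) -> <-]; exact: linear0.
  have [|q qI _] := @quot_embed _ _ _ (dom G') (proj T \o proj (dom G))%FUN.
    by move=> b; rewrite domG' /=; exact: proj_eq0.
  exact: (locally_torsion_free_sub qI locT).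
apply: (Zmax (fun z => G' z)); last first.
  exists G' => // z; split=> [|[//|[a <-]]]; first by left.
  by rewrite iuE; apply/GG'/Giu.
split=> [z Zz|G'Z]; first by apply/GG'/GE; left.
have /incl_onto[x0 x0E] : T' b0 by exact: Tb0.
apply: nGb0; exists (h x0); apply/GE; left; apply: G'Z.
by exists x0; rewrite kE x0E.
Qed.

Lemma locally_torsion_free_Y (C : lmodType S) :
  Reiten_Ringel X Y -> locally_torsion_free Y C -> Y C.
Proof.
move=> RR locC; apply/YE; apply: (ext1_zero_lifts io_pi).
apply: locally_torsion_free_ext1_zero RR _ locC => F _ /YE.
exact: (lifts_ext1_zero io_pi injE0).
Qed.

(** The map is extended first to [G], the preimage of [tau C], by means of purity, and then to [B]
    because the quotient of [C] by [tau C] is in [Y]. *)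
Lemma ext1_zero_pure_injective (V : lmodType S) :
  (forall C, locally_torsion_free Y C -> Y C) ->
  Y V -> (forall C, Y C -> ext1_zero C V) -> pure_injective V.
Proof.
move=> locY YV extV A B C f g u [[fI ex g_onto] pure].
have gf a : g (f a) = 0 by apply/ex; exists a.
pose G := preim_sub g (tau XY C).
have lift_fg (P : submodule C) : fg_sub P ->
    exists k : {linear submod P -> B}, forall x, g (k x) = incl P x.
  by move=> fgP; apply: pure; apply: fg_finitely_presented; rewrite // -fg_subP.
have X_range (Z : lmodType S) (k : {linear Z -> B}) : X Z -> X (submod (range_sub k)).
  move=> XZ; have [|k' k'E] := @corestrict _ _ (range_sub k) _ k.
    by move=> z; exists z.
  apply: (torsion_quotient XY (f := k')) XZ => y.
  by have [z zE] := inclP y; exists z; apply: incl_inj; rewrite k'E.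
have tau_image y : tau XY B y -> tau XY C (g y).
  move=> [P [fgP XP Py]]; exists (image_sub g P).
  split; [exact: fg_image| |by exists y].
  have [|g' g'E] := @corestrict _ _ (image_sub g P) _ (g \o incl P)%FUN.
    by move=> x; exists (incl P x) => //; exact: inclP.
  apply: (torsion_quotient XY (f := g')) XP => z.
  have [_ /incl_onto[x <-] xE] := inclP z.
  by exists x; apply: incl_inj; rewrite g'E.
(* Purity splits [g] over the image of [P]. Subtracting the splitting gives a map [d'] from [P] to
   [A] that sends [z] to [a], and [u d'] goes from [X] to [Y]. *)
have kill a y : tau XY B y -> f a = y -> u a = 0.
  move=> [P [fgP XP /incl_onto[z <-]]] faz.
  have [|q qE] := @corestrict _ _ (image_sub g P) _ (g \o incl P)%FUN.
    by move=> x; exists (incl P x) => //; exact: inclP.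
  have [l lE] := lift_fg _ (fg_image g fgP).
  have [d dE] := linear_sub_exists (incl P) (l \o q)%FUN.
  have [|d' d'E] := @lift_inj _ _ _ _ f d fI.
    by move=> x; apply/ex; rewrite dE linearB /= lE qE subrr.
  have -> : a = d' z.
    apply: fI; rewrite d'E dE /= faz.
    suff -> : q z = 0 by rewrite linear0 subr0.
    by apply: incl_inj; rewrite qE linear0 /= -faz.
  exact: (torsion_hom0 XY (u \o d')%FUN _ XP YV).
have [|q qE] := @linear_exists _ (A * submod (tau XY B))%type B
    (fun z => f z.1 + incl _ z.2).
  by move=> a x y; rewrite !linearP scalerDr addrACA.
have [|q' q'E] := @corestrict _ _ G _ q.
  move=> z; change (tau XY C (g (q z))); rewrite qE linearD gf add0r.
  exact/tau_image/inclP.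
have [|w wE] := @linear_exists _ (A * submod (tau XY B))%type V (fun z => u z.1).
  by move=> a x y; rewrite linearP.
(* By purity [G] is the sum of the image of [A] and [tau B]; by [kill], the rule [f a + y] to [u a]
   is well defined on it. *)
have [||u1 u1E] := @factor_onto _ _ _ _ q' w.
- move=> b; have [P [fgP XP /incl_onto[x xE]]] : G (incl G b) by exact: inclP.
  have [k kE] := lift_fg P fgP.
  have [a aE] : exists a, f a = incl G b - k x.
    by apply/ex; rewrite linearB /= kE xE subrr.
  have /incl_onto[y yE] : tau XY B (k x).
    exists (range_sub k).
    split; [exact/fg_range/fg_subP | exact: X_range | by exists x].
  by exists (a, y); apply: incl_inj; rewrite q'E qE /= aE yE subrK.
- move=> [a y] /(congr1 (incl G)); rewrite q'E qE linear0 wE /= => fay.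
  apply: (kill a (- incl _ y)); first exact/subN/inclP.
  by apply/eqP; rewrite -addr_eq0 fay.
have Yq : Y (quot (tau XY C)) by apply: locY; exact: tau_locally.
have [|h hE] := extV _ Yq _ _ (incl G) (proj (tau XY C) \o g)%FUN u1.
  split=> [|b|c]; first exact: incl_inj.
    rewrite /= proj_eq0; split=> [Gb|[x <-]]; last exact: (inclP x).
    exact: (@incl_onto _ _ G).
  have [y <-] := proj_onto c; have [b <-] := g_onto y.
  by exists b.
exists h => a; have -> : f a = incl G (q' (a, 0)).
  by rewrite q'E qE /= linear0 addr0.
by rewrite hE u1E wE.
Qed.

Lemma Reiten_Ringel_Sigma_pure_injective :
  Reiten_Ringel X Y -> Sigma_pure_injective U.
Proof.
move=> RR I; apply: ext1_zero_pure_injective.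
- by move=> C; exact: locally_torsion_free_Y.
- have [ev evE] := choice (fun i : I =>
    @linear_exists _ (direct_sum I U) U (fun x => x i) (fun _ _ _ => erefl)).
  apply: (torsion_free_product XY (f := ev)) => // x x0.
  by apply: val_inj; apply: funext => i; rewrite -[LHS]evE x0.
move=> C YC; apply: locally_torsion_free_ext1_zero RR _ _.
  by move=> F; exact: fg_ext1_zero_direct_sum.
by move=> N f _ fI; exact: torsion_free_sub XY _ _ f fI YC.
Qed.

End ReitenRingelSigma.

(** * Cotilting modules in terms of lifts, and the equivalence *)

Lemma cotilting_lifts (S : pzRingType) (X Y : lmodType S -> Prop) (U : lmodType S) :
  one_cotilting U -> cogenerates U X Y ->
  [/\ torsion_pair X Y, Y U
    & exists (E0 E1 : lmodType S) (io : {linear U -> E0}) (pi : {linear E0 -> E1}),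
      [/\ short_exact io pi, injective_module E0, injective_module E1
        & forall M, Y M <-> lifts pi M]].
Proof.
move=> [ExtU [E0 [E1 [io [pi [io_pi injE0 injE1]]]]] _] [XY YExt]; split=> //.
  (* [U] embeds in its power indexed by [unit], which lies in [Y] by the vanishing on powers. *)
  have [|c cE] := @linear_exists _ U (unit -> U) (fun u _ => u); first by [].
  apply: (torsion_free_sub XY (f := c)).
    by move=> x y /(congr1 (fun f => f tt)); rewrite !cE.
  by apply/YExt => j j0; exact: ExtU.
exists E0, E1, io, pi; split=> // M; rewrite YExt; split=> [ExtM|liftM j].
  exact: (Ext1_lifts io_pi (ExtM 1%N isT)).
exact: (lifts_Ext io_pi injE0 injE1).
Qed.

Theorem theorem4p3 (R : pzRingType) (X Y : lmodType R^c -> Prop) :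
  right_noetherian R ->
  cotilting_torsion_pair X Y ->
  [<-> Reiten_Ringel X Y;
       forall U : lmodType R^c,
         one_cotilting U -> cogenerates U X Y -> Sigma_pure_injective U;
       exists U : lmodType R^c,
         [/\ Sigma_pure_injective U, one_cotilting U & cogenerates U X Y]].
Proof.
move=> noethR [U0 [cotU0 genU0]]; tfae.
- move=> RR U cotU genU.
  have [XY YU [E0 [E1 [io [pi [ex injE0 injE1 YE]]]]]] := cotilting_lifts cotU genU.
  exact: (Reiten_Ringel_Sigma_pure_injective XY noethR ex injE0 YE YU RR).
- by move=> SU; exists U0; split=> //; exact: SU.
move=> [U [SU cotU genU]].
have [XY YU [E0 [E1 [io [pi [ex injE0 injE1 YE]]]]]] := cotilting_lifts cotU genU.
exact: (Sigma_pure_injective_Reiten_Ringel XY ex YE YU noethR SU).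
Qed.
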